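(* Let $\eta_1,\eta_2,\dots$ be iid random vectors in $\mathbb{R}^d$ with $\mathbb{E}[\eta_i]=0$, $\mathbb{E}[\eta_i\eta_i^T]=I$ and $\|\eta_i\|_2\le\beta$ almost surely for some constant $\beta$. Let $S_k:=\frac{1}{\sqrt k}\sum_{i=1}^k\eta_i$, let $q_k$ be the distribution of $S_k$ and let $p^*=N(0,I)$. Then $$W_2(q_k,p^* )=\tilde O\left(\frac{d^{3/2}}{\sqrt k}\right).$$
   Context: $W_2$ is the 2-Wasserstein distance on $\mathbb{R}^d$. $\tilde O$ hides logarithmic factors in $k$ and a constant depending only on the almost sure bound $\beta$: the conclusion means that there are a constant $C$ depending only on $\beta$ and an absolute constant $a$ with $W_2(q_k,p^* )\le C\,d^{3/2}(\log k)^a/\sqrt k$ for all $k\ge2$. *)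

(* Defs.v *)
From HB Require Import structures.
From mathcomp Require Import all_boot all_order all_algebra.
From mathcomp Require Import all_classical all_reals all_analysis.
From mathcomp Require Import measurable_realfun.
Import Order.TTheory GRing.Theory Num.Theory.
Import numFieldNormedType.Exports.

Set Implicit Arguments.
Unset Strict Implicit.
Unset Printing Implicit Defensive.

Local Open Scope classical_set_scope.
Local Open Scope ring_scope.

(* Row vectors carry the sigma-algebra generated by the coordinates (as
   n.-tuple T does in the library).  For T := R : realType this is the Borel
   sigma-algebra of R^n. *)
Definition measure_rV_display : measure_display -> measure_display.
Proof. exact. Qed.

Section measurable_rV.
Context {d : measure_display} {T : measurableType d}.
Variable n : nat.

Let coors : 'I_n -> 'rV[T]_n -> T := fun i x => x ord0 i.

Let rV_set0 : g_sigma_preimage coors set0.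
Proof. exact: sigma_algebra0. Qed.

Let rV_setC A : g_sigma_preimage coors A -> g_sigma_preimage coors (~` A).
Proof. exact: sigma_algebraC. Qed.

Let rV_bigcup (F : _^nat) : (forall i, g_sigma_preimage coors (F i)) ->
  g_sigma_preimage coors (\bigcup_i (F i)).
Proof. exact: sigma_algebra_bigcup. Qed.

HB.instance Definition _ := @isMeasurable.Build (measure_rV_display d)
  'rV[T]_n (g_sigma_preimage coors) rV_set0 rV_setC rV_bigcup.

End measurable_rV.

Lemma measurable_coord d (T : measurableType d) n (i : 'I_n) :
  measurable_fun [set: 'rV[T]_n] (fun x : 'rV[T]_n => x ord0 i).
Proof.
move=> _ Y mY; rewrite setTI; apply: sub_sigma_algebra => /=.
rewrite -bigcup_seq/=; exists i => /=; first by rewrite mem_index_enum.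
by exists Y => //; rewrite setTI.
Qed.

Lemma measurable_fun_rVP d1 d2 (T1 : measurableType d1)
    (T2 : measurableType d2) n (f : T1 -> 'rV[T2]_n) :
  measurable_fun [set: T1] f <->
  forall i, measurable_fun [set: T1] (fun x => f x ord0 i).
Proof.
split=> [mf i|mf].
  exact: (measurableT_comp (@measurable_coord _ _ _ i) mf).
move=> _ A mA; rewrite setTI.
have : (g_sigma_preimage (fun (i : 'I_n) x => f x ord0 i)) (f @^-1` A).
  rewrite (g_sigma_preimage_comp (fun (i : 'I_n) (v : 'rV[T2]_n) => v ord0 i) f).
  by exists A => //; rewrite setTI.
apply: smallest_sub; first exact: sigma_algebra_measurable.
rewrite -bigcup_seq; apply: bigcup_sub => i _ B [C mC <-].
exact: mf.
Qed.

(* The library's norm `|x| on matrices is the sup norm. *)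
Definition enorm (R : realType) (n : nat) (x : 'rV[R]_n) : R :=
  Num.sqrt (\sum_(i < n) x ord0 i ^+ 2).

Section std_normal.
Variable R : realType.

(* measurableTypeR R is the copy of R on which normal_prob is a measure. *)
Definition row_cons (n : nat) (xv : measurableTypeR R * 'rV[R]_n) : 'rV[R]_n.+1 :=
  \row_i oapp (fun j => xv.2 ord0 j) xv.1 (unlift ord0 i).

Lemma measurable_row_cons n : measurable_fun setT (@row_cons n).
Proof.
apply/measurable_fun_rVP => i.
under eq_fun do rewrite mxE.
case: unliftP => [j _|_] /=; last exact: measurable_fst.
exact: (measurableT_comp (@measurable_coord _ _ _ j) measurable_snd).
Qed.

HB.instance Definition _ (n : nat) :=
  isMeasurableFun.Build _ _ _ _ (@row_cons n) (@measurable_row_cons n).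

(* N(0, I) on R^n, as the n-fold product of N(0, 1); see std_normal_box. *)
Fixpoint std_normal (n : nat) : probability 'rV[R]_n R :=
  match n with
  | 0 => \d_(0 : 'rV[R]_0)
  | m.+1 => distribution (normal_prob (0 : R) 1 \x std_normal m)%E
              (@row_cons m)
  end.

Lemma std_normal_box n (A : 'I_n -> set R) : (forall i, measurable (A i)) ->
  std_normal n [set x | forall i, A i (x ord0 i)] =
  (\prod_(i < n) normal_prob (0 : R) 1 (A i))%E.
Proof.
elim: n A => [|n IH] A mA.
  rewrite big_ord0 /= diracE mem_set//=; by case.
have mB : measurable [set x : 'rV[R]_n | forall i, A (lift ord0 i) (x ord0 i)].
  rewrite (_ : [set _ | _] =
    \bigcap_(i in [set: 'I_n]) ((fun x : 'rV[R]_n => x ord0 i) @^-1`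
       (A (lift ord0 i)))); last first.
    apply/seteqP; split=> x /= H i => [_|]; exact: H.
  apply: fin_bigcap_measurable => // i _.
  rewrite -[X in measurable X]setTI; exact: measurable_coord.
rewrite big_ord_recl -(IH (fun i => A (lift ord0 i)))//.
rewrite -product_measure1E//; last exact: (mA ord0).
rewrite /= /distribution /pushforward; congr (_ _).
apply/seteqP; split=> -[x v] /=.
  move=> H; split=> [|i].
    by have := H ord0; rewrite mxE unlift_none.
  by have := H (lift ord0 i); rewrite mxE liftK.
by move=> [Hx Hv] i; rewrite mxE; case: unliftP => [j ->|->].
Qed.

End std_normal.

Section wasserstein.
Variables (R : realType) (n : nat).
Implicit Types mu nu : probability 'rV[R]_n R.

Definition couplings mu nu :
    set (probability ('rV[R]_n * 'rV[R]_n)%type R) :=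
  [set gamma | forall A : set 'rV[R]_n, measurable A ->
     gamma (A `*` setT) = mu A /\ gamma (setT `*` A) = nu A].

Definition W2 mu nu : \bar R :=
  (ereal_inf [set (\int[gamma]_z (enorm (z.1 - z.2) ^+ 2)%:E)%E
             | gamma in couplings mu nu] `^ 2^-1)%E.

End wasserstein.

Section iid.
Context {d d' : measure_display} {T : measurableType d} {V : measurableType d'}
  {R : realType}.
Variables (P : probability T R) (X : nat -> {RV P >-> V}).

Definition mutually_independent : Prop :=
  forall (J : seq nat) (A : nat -> set V), uniq J ->
    (forall i, measurable (A i)) ->
    P (\bigcap_(i in [set` J]) (X i @^-1` A i)) =
    (\prod_(i <- J) P (X i @^-1` A i))%E.

Definition identically_distributed : Prop :=
  forall (i j : nat) (A : set V), measurable A ->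
    distribution P (X i) A = distribution P (X j) A.

Definition iid : Prop := mutually_independent /\ identically_distributed.

End iid.

Section normalized_sum.
Context {d : measure_display} {T : measurableType d} {R : realType} {n : nat}.

(* The sequence is indexed from 0: the k summands are eta 0, ..., eta (k-1). *)
Definition normalized_sum (eta : nat -> {mfun T >-> 'rV[R]_n}) (k : nat)
    (w : T) : 'rV[R]_n :=
  (Num.sqrt (k%:R : R))^-1 *: \sum_(i < k) eta i w.

Lemma measurable_normalized_sum (eta : nat -> {mfun T >-> 'rV[R]_n}) k :
  measurable_fun setT (normalized_sum eta k).
Proof.
apply/measurable_fun_rVP => j.
under eq_fun do rewrite mxE summxE.
apply: measurable_funM => //; apply: measurable_sum => i.
exact: (measurableT_comp (@measurable_coord _ _ _ j) (measurable_funPT (eta i))).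
Qed.

HB.instance Definition _ (eta : nat -> {mfun T >-> 'rV[R]_n}) (k : nat) :=
  isMeasurableFun.Build _ _ _ _ (normalized_sum eta k)
    (@measurable_normalized_sum eta k).

End normalized_sum.

(* Main.v *)
(* The bound on the norms forces [d <= beta ^+ 2], so constants may depend on
   the dimension.  Replace the summands by Gaussians one at a time: if [S_m] is
   coupled with [sqrt m Z], couple [S_(m+1) = S_m + X] with
   [sqrt (m+1) F (X + sqrt m Z)], where [F] is a map sending the law of
   [Y = X + sqrt m Z] to N(0, I).  Since [F] is a map, no gluing of couplings is
   needed, and by Minkowski's inequality the errors
   [|sqrt (m+1) F Y - Y|_(L^2)] add up; each is O((ln k)^3 / m), so that the
   coupling at time [k] has error O((ln k)^4), to be divided by [sqrt k].

   For [F] take the Knothe map, one coordinate at a time: by the Cameron-Martin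
   formula, given that the other coordinates of [Y] equal [v], the coordinate
   [Y_0] is distributed as [X_0 + sqrt m Z_0] with the law of [X] tilted by
   [exp (<X', v> / m - |X'|^2 / (2 m))], and is sent to N(0, 1) by the monotone
   map.  As the first two moments of [X] and of N(0, I) agree, a Taylor
   expansion of the distribution functions leaves only third-order terms when
   [|Y| <= sqrt m ln m]; the complement has polynomially small probability. *)
Require Import Defs.
From HB Require Import structures.
From mathcomp Require Import all_boot all_order all_algebra.
From mathcomp Require Import all_classical all_reals all_analysis.
From mathcomp Require Import measurable_realfun.
From mathcomp Require Import ring lra.
Import Order.TTheory GRing.Theory Num.Theory.
Import numFieldNormedType.Exports.
Set Implicit Arguments.
Unset Strict Implicit.
Unset Printing Implicit Defensive.
Local Open Scope classical_set_scope.
Local Open Scope ring_scope.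

(** * Measures with a density *)

(** One replacement has to be cheap in mean square, whereas the Taylor expansion needs [K L <= s]
    and [|Y_j| <= s L] for all [j], where [s = sqrt m]. Both exceptions are paid for by exponential
    moments: the means of [exp |Y_j / s|] and [exp |F(Y)_i|] are at most [4 exp beta] and 4. With
    [L = 8 (1 + ln m)] one has [exp L >= s ^ 16], so a large [Y] makes the first moment exceed any
    power of [s] in sight. If [K L > s], the crude squared error of order [s ^ 2] is at most of
    order [(K L) ^ 6 / s ^ 4]; this case, and not the expansion with its error [L ^ 2 / m], is what
    puts a cube on the logarithm. Summing [1 / m] gives the fourth power.

    In the expansion with [e = 1 / s], the first-order term vanishes because the mean is zero, the
    tilt term because distinct coordinates are uncorrelated, and the remaining one because the
    variance is 1. What survives at second order, [u e ^ 2 / 2], is the effect of the variance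
    growing from [m] to [m + 1], and the factor [sqrt (m + 1)] compensates it. *)

Section density.
Local Open Scope ereal_scope.
Context d (T : measurableType d) (R : realType).
Variables (mu : {measure set T -> \bar R}) (g : T -> R).
Hypotheses (mg : measurable_fun setT g) (g0 : forall x, (0 <= g x)%R).

(** The two proofs are arguments so that the measure structure can be recovered from the term
    itself. *)
Definition mdensity of measurable_fun setT g & (forall x, (0 <= g x)%R) :=
  fun A : set T => \int[mu]_(x in A) (g x)%:E.

Local Notation nu := (mdensity mg g0).

Let nu0 : nu set0 = 0.
Proof. exact: integral_set0. Qed.

Let nu_ge0 A : 0 <= nu A.
Proof. by apply: integral_ge0 => x _; rewrite lee_fin. Qed.

Let nu_sigma_additive : semi_sigma_additive nu.
Proof.
move=> A mA tA mUA; rewrite /mdensity ge0_integral_bigcup//; last 2 first.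
- exact/measurable_funTS/measurable_EFinP.
- by move=> x _; rewrite lee_fin.
apply: is_cvg_ereal_nneg_natsum_cond => n _ _; exact: nu_ge0.
Qed.

HB.instance Definition _ := isMeasure.Build _ _ _ nu
  nu0 nu_ge0 nu_sigma_additive.

Import HBNNSimple.

(** Monotone convergence reduces both sides to simple functions, and linearity to indicators, where
    the identity is the definition of [mdensity]. *)
Lemma ge0_integral_mdensity (f : T -> \bar R) :
    measurable_fun setT f -> (forall x, 0 <= f x) ->
  \int[nu]_x f x = \int[mu]_x (f x * (g x)%:E).
Proof.
move=> mf f0; pose h := nnsfun_approx measurableT mf.
have hf x : (h n x)%:E @[n --> \oo] --> f x by exact: cvg_nnsfun_approx.
have nd_h x : nondecreasing_seq (fun n => (h n x)%:E).
  by move=> a b ab; rewrite lee_fin; exact/lefP/nd_nnsfun_approx.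
have mEg : measurable_fun setT (EFin \o g) by exact/measurable_EFinP.
have -> : \int[nu]_x f x = limn (fun n => \int[nu]_x (h n x)%:E).
  rewrite -monotone_convergence//.
  - by apply: eq_integral => x _; apply/esym/cvg_lim => //; exact: hf.
  - by move=> n; exact/measurable_EFinP.
  - by move=> n x _; rewrite lee_fin.
have -> : \int[mu]_x (f x * (g x)%:E) =
    limn (fun n => \int[mu]_x ((h n x)%:E * (g x)%:E)).
  rewrite -monotone_convergence//.
  - apply: eq_integral => x _; apply/esym/cvg_lim => //.
    by apply: cvgeZr => //; exact: hf.
  - by move=> n; apply: emeasurable_funM => //; exact/measurable_EFinP.
  - by move=> n x _; rewrite mule_ge0// lee_fin.
  - move=> x _ a b ab; rewrite lee_wpmul2r//; [by rewrite lee_fin|exact: nd_h].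
congr (limn _); apply/funext => n.
have mi r : measurable_fun setT (fun x => (r * \1_(h n @^-1` [set r]) x)%:E).
  by apply/measurable_EFinP; exact: measurable_funM.
transitivity (\int[nu]_x \sum_(r \in range (h n))
    (r * \1_(h n @^-1` [set r]) x)%:E).
  by apply: eq_integral => x _; rewrite fsumEFin// -fimfunE.
rewrite ge0_integral_fsum//; last by move=> r x _; exact: nnfun_muleindic_ge0.
transitivity (\int[mu]_x \sum_(r \in range (h n))
    ((r * \1_(h n @^-1` [set r]) x)%:E * (g x)%:E)); last first.
  apply: eq_integral => x _; rewrite -ge0_mule_fsuml; last first.
    by move=> r; exact: nnfun_muleindic_ge0.
  by rewrite fsumEFin// -fimfunE.
rewrite ge0_integral_fsum//; last 2 first.
- by move=> r; apply: emeasurable_funM.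
- by move=> r x _; rewrite mule_ge0 ?lee_fin//; exact: nnfun_muleindic_ge0.
apply: eq_fsbigr => r /[!inE] -[t _ rt].
have r0 : (0 <= r)%R by rewrite -rt.
rewrite integralZl_indic_nnsfun//= integral_indic//= setIT.
under [RHS]eq_integral do rewrite EFinM -muleA.
rewrite ge0_integralZl//; last 2 first.
- by apply: emeasurable_funM => //; exact/measurable_EFinP.
- by move=> x _; rewrite mule_ge0// lee_fin.
congr (_ * _); rewrite /nu/= /mdensity -(setTI (_ @^-1` _)) integral_mkcondr.
by apply: eq_integral => x _; rewrite epatch_indic muleC setTI.
Qed.

End density.

(** * The standard Gaussian measure on the line *)

Section lebesgue_shift.
Local Open Scope ereal_scope.
Context {R : realType}.
Local Notation mu := (@lebesgue_measure R).

(** Lebesgue measure is determined by the lengths of half-open intervals, which a translation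
    preserves. *)
Lemma ge0_integral_lebesgue_shift (a : R) (f : R -> \bar R) :
    measurable_fun setT f -> (forall x, 0 <= f x) ->
  \int[mu]_x f (x + a)%R = \int[mu]_x f x.
Proof.
move=> mf f0.
have ma : measurable_fun setT ((fun x : R => x + a)%R : measurableTypeR R -> measurableTypeR R).
  exact: measurable_funD.
rewrite -[LHS](@ge0_integral_pushforward _ _ _ _ R _ ma mu setT f)//.
apply: eq_measure_integral => A mA _; apply/esym.
apply: (@lebesgue_measure_unique _ (pushforward mu _)) => // _ [[b c]] _ <-.
rewrite /pushforward /=.
rewrite [X in _ = mu X](_ : _ = `](b - a)%R, (c - a)%R]%classic); last first.
  by apply/seteqP; split=> x /=; rewrite !in_itv/= ltrBlDr lerBrDr.
rewrite !lebesgue_measure_itv/= !lte_fin ltrD2r; case: ifPn => // _.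
by rewrite -!EFinD opprB addrA subrK.
Qed.

End lebesgue_shift.

(* [normal_prob] lives on the copy [measurableTypeR R] of R, whose measurable
   structure differs from the canonical one of R by its display. *)
Section gauss.
Variable R : realType.

Definition of_measurableTypeR : measurableTypeR R -> R := idfun.

Lemma measurable_of_measurableTypeR : measurable_fun setT of_measurableTypeR.
Proof. by move=> _ A mA; rewrite setTI. Qed.

HB.instance Definition _ := isMeasurableFun.Build _ _ _ _
  of_measurableTypeR measurable_of_measurableTypeR.

Definition gauss : probability R R :=
  distribution (normal_prob (0 : R) 1) of_measurableTypeR.

Lemma ge0_integral_gauss (f : R -> \bar R) :
    measurable_fun setT f -> (forall x, 0 <= f x)%E ->
  (\int[gauss]_x f x = \int[normal_prob (0 : R) 1]_x f x)%E.
Proof. by move=> mf f0; rewrite ge0_integral_distribution. Qed.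

End gauss.
Arguments gauss {R}.

Section gaussian.
Context {R : realType}.
Implicit Types x y z a u : R.
Local Notation mu := (@lebesgue_measure R).
Local Notation N1 := (@gauss R).

Definition gauss_pdf : R -> R := normal_pdf 0 1.

Lemma gauss_pdfE x : gauss_pdf x = gauss_pdf 0 * expR (- (x ^+ 2 / 2)).
Proof.
rewrite /gauss_pdf normal_pdfE ?oner_neq0// /normal_fun !subr0 expr1n.
by rewrite expr0n/= oppr0 mul0r expR0 mulr1 mulNr.
Qed.

Lemma gauss_pdf_gt0 x : 0 < gauss_pdf x.
Proof.
rewrite gauss_pdfE mulr_gt0 ?expR_gt0//.
rewrite /gauss_pdf normal_pdfE ?oner_neq0// mulr_gt0 ?normal_peak_gt0 ?oner_neq0//.
exact: expR_gt0.
Qed.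

Lemma gauss_pdf_le x : gauss_pdf x <= gauss_pdf 0.
Proof.
rewrite [leLHS]gauss_pdfE ler_piMr //; first exact/ltW/gauss_pdf_gt0.
by rewrite -[leRHS]expR0 ler_expR oppr_le0 divr_ge0// sqr_ge0.
Qed.

Lemma continuous_gauss_pdf : continuous gauss_pdf.
Proof. exact/continuous_normal_pdf/oner_neq0. Qed.

Lemma measurable_gauss_pdf : measurable_fun setT gauss_pdf.
Proof. exact: measurable_normal_pdf. Qed.

(** The exponential is the density of N(a, 1) relative to N(0, 1). It serves twice: in the change of
    variables below and in the derivative of [Phi_diff]. *)
Lemma gauss_pdf_shift x a :
  gauss_pdf (x - a) = gauss_pdf x * expR (a * x - a ^+ 2 / 2).
Proof.
rewrite gauss_pdfE [in RHS]gauss_pdfE -mulrA -expRD; congr (_ * expR _).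
by field.
Qed.

Lemma ge0_integral_gaussE (f : R -> \bar R) :
  measurable_fun setT f -> (forall x, 0 <= f x)%E ->
  (\int[N1]_x f x = \int[mu]_x (f x * (gauss_pdf x)%:E))%E.
Proof.
move=> mf f0.
have p0 x : 0 <= gauss_pdf x by exact/ltW/gauss_pdf_gt0.
by rewrite ge0_integral_gauss// -(ge0_integral_mdensity mu measurable_gauss_pdf p0).
Qed.

(** The Cameron-Martin formula on the line. *)
Lemma ge0_integral_gauss_shift a (f : R -> \bar R) :
  measurable_fun setT f -> (forall x, 0 <= f x)%E ->
  (\int[N1]_x f (x + a)%R =
   \int[N1]_x (f x * (expR (a * x - a ^+ 2 / 2))%:E))%E.
Proof.
move=> mf f0.
have ma (g : R -> \bar R) : measurable_fun setT g -> measurable_fun setT (fun x : R => g (x + a)).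
  move=> mg; apply: (measurableT_comp mg).
  exact: measurable_funD.
have me : measurable_fun setT (fun x : R => (expR (a * x - a ^+ 2 / 2))%:E).
  apply/measurable_EFinP; apply: measurableT_comp => //.
  by apply: measurable_funB => //; exact: measurable_funM.
rewrite ge0_integral_gaussE//; last exact: ma.
rewrite ge0_integral_gaussE//; last 2 first.
- exact: emeasurable_funM.
- by move=> x; rewrite mule_ge0 ?lee_fin ?expR_ge0.
rewrite -[RHS](ge0_integral_lebesgue_shift a); last 2 first.
- apply: emeasurable_funM; first exact: emeasurable_funM.
  by apply/measurable_EFinP; exact: measurable_gauss_pdf.
- by move=> x; rewrite !mule_ge0 ?lee_fin ?expR_ge0// ltW ?gauss_pdf_gt0.
apply: eq_integral => x _; rewrite -muleA -EFinM; congr (_ * _%:E)%E.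
by rewrite mulrC -gauss_pdf_shift addrK.
Qed.

Lemma integral_gauss_expR a :
  (\int[N1]_x (expR (a * x - a ^+ 2 / 2))%:E = 1)%E.
Proof.
have := @ge0_integral_gauss_shift a (cst 1%E) (measurable_cst _).
rewrite integral_cst//= mul1e probability_setT => ->//.
by apply: eq_integral => x _; rewrite mul1e.
Qed.

(** Since [2 exp (-1/2) >= 1], the integrand is dominated by twice the sum of the densities of N(1,
    1) and N(-1, 1) relative to N(0, 1), each of mean 1. All later moment and tail estimates rest on
    this bound. *)
Lemma integral_gauss_expR_norm :
  (\int[N1]_x (expR `|x|)%:E <= 4%:E)%E.
Proof.
have me a : measurable_fun setT (fun x : R => (expR (a * x - a ^+ 2 / 2))%:E).
  apply/measurable_EFinP; apply: measurableT_comp => //.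
  by apply: measurable_funB => //; exact: measurable_funM.
apply: (@le_trans _ _ (\int[N1]_x ((2%:E * (expR (1 * x - 1 ^+ 2 / 2))%:E) +
    2%:E * (expR (-1 * x - (-1) ^+ 2 / 2))%:E))%E).
  apply: ge0_le_integral => //.
  - by apply/measurable_EFinP; do 2 apply: measurableT_comp => //.
  - by apply: emeasurable_funD; apply: emeasurable_funM.
  - move=> x _; rewrite -!EFinM -EFinD lee_fin.
    have e2 : 1 <= 2 * expR (- (1 / 2)) :> R.
      by have := expR_ge1Dx (- (1 / 2) : R); lra.
    have h t : expR t <= 2 * expR (t - 1 / 2) :> R.
      by rewrite expRD mulrCA ler_peMr// expR_ge0.
    rewrite expr1n sqrrN expr1n mul1r mulN1r.
    case: (lerP 0 x) => x0.
      by rewrite (ger0_norm x0) (le_trans (h _))// lerDl mulr_ge0// expR_ge0.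
    by rewrite (ltr0_norm x0) (le_trans (h _))// lerDr mulr_ge0// expR_ge0.
rewrite ge0_integralD//; try exact: emeasurable_funM.
rewrite !ge0_integralZl//.
by rewrite !integral_gauss_expR !mule1 -EFinD lee_fin; lra.
Qed.

End gaussian.

(** * The Gaussian distribution function *)

Section mean_value.
Context {R : realType}.

Lemma mean_value_le (f df : R -> R) (a b K : R) :
  (forall t, is_derive t (1 : R) f (df t)) ->
  (forall t, Num.min a b <= t <= Num.max a b -> `|df t| <= K) ->
  `|f b - f a| <= K * `|b - a|.
Proof.
wlog ab : a b / a <= b.
  move=> H fd dfK; case: (leP a b) => [|/ltW] ba; first exact: H.
  by rewrite distrC (distrC b); apply: H => // t; rewrite minC maxC; exact: dfK.
move=> fd; rewrite min_l// max_r// => dfK.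
have cf : {within `[a, b], continuous f}.
  apply: continuous_subspaceT => x.
  by apply: differentiable_continuous; apply/derivable1_diffP; case: (fd x).
have [c] := @MVT_segment _ f df a b ab (fun x _ => fd x) cf.
rewrite in_itv/= => cab ->.
by rewrite normrM ler_wpM2r ?normr_ge0 ?dfK.
Qed.

(** This is the tangent bound for [expR (- a)]. Together with [expR_ge1Dx] it encloses [expR a] for
    small [a]. *)
Lemma expR_mul1B_le (a : R) : expR a * (1 - a) <= 1.
Proof.
rewrite -[leRHS](@divff _ (expR a)) ?gt_eqF ?expR_gt0// -expRN.
by rewrite ler_pM2l ?expR_gt0// expR_ge1Dx.
Qed.

Lemma expR_sub1_le (a : R) : `|a| <= 1 / 2 -> `|expR a - 1| <= 2 * `|a|.
Proof.
rewrite ler_norml => /andP[a1 a2].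
have h1 := expR_ge1Dx a; have h3 := expR_mul1B_le a; have e0 := expR_gt0 a.
have e1 : expR a <= 1 + 2 * `|a|.
  have [a0|a0] := leP 0 a.
    by rewrite ger0_norm// -(@ler_pM2r _ (1 - a)) ?(le_trans h3)//; [nra|lra].
  by rewrite (@le_trans _ _ 1) ?lerDl ?mulr_ge0// -expR0 ler_expR ltW.
have := normr_ge0 a; have := ler_norm a; have := ler_normr a (- a).
rewrite normrN; move: e1; case: (leP 0 a) => a0.
  by rewrite ger0_norm// ler_norml => *; apply/andP; split; lra.
by rewrite ltr0_norm// ler_norml => *; apply/andP; split; lra.
Qed.

Lemma expR_sub1D_le (a : R) : `|a| <= 1 / 2 -> `|expR a - 1 - a| <= 2 * a ^+ 2.
Proof.
rewrite ler_norml => /andP[a1 a2].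
have h1 := expR_ge1Dx a; have h3 := expR_mul1B_le a; have e0 := expR_gt0 a.
rewrite ler_norml; apply/andP; split; first nra.
have : expR a * (1 - a) <= (1 + a + 2 * a ^+ 2) * (1 - a) by nra.
rewrite ler_pM2r; last lra.
lra.
Qed.

End mean_value.

Section Phi.
Context {R : realType}.
Implicit Types x y z a b u : R.
Local Notation mu := (@lebesgue_measure R).

Definition Phi x : R := fine (gauss `]-oo, x]%classic).

Lemma gauss_itvE x : gauss `]-oo, x]%classic = (Phi x)%:E.
Proof. by rewrite /Phi fineK// fin_num_measure. Qed.

Lemma is_derive_Phi x : is_derive x (1 : R) Phi (gauss_pdf x).
Proof.
have ip : mu.-integrable [set` Interval -oo%O (BRight (x + 1))] (EFin \o @gauss_pdf R).
  by apply: (integrableS measurableT) => //; exact: integrable_normal_pdf.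
have xx1 : x < x + 1 by rewrite ltrDl.
have := continuous_FTC1 xx1 ip _ (@continuous_gauss_pdf R x).
rewrite ltNyr => /(_ isT)/=[d1 d2].
have -> : Phi = fun y => (\int[mu]_(t in `]-oo, y]) gauss_pdf t)%R by [].
by apply: DeriveDef; [exact: d1|rewrite -derive1E; exact: d2].
Qed.

Lemma Phi_ge0 x : 0 <= Phi x.
Proof. by rewrite /Phi fine_ge0. Qed.

Lemma Phi_le1 x : Phi x <= 1.
Proof. by rewrite -lee_fin -gauss_itvE probability_le1. Qed.

Lemma continuous_Phi : continuous Phi.
Proof.
move=> x; apply: differentiable_continuous; apply/derivable1_diffP.
by case: (is_derive_Phi x).
Qed.

Lemma measurable_Phi : measurable_fun setT Phi.
Proof. by apply: continuous_measurable_fun; exact: continuous_Phi. Qed.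

Lemma Phi_mean_value a b : a < b ->
  exists2 c, a < c < b & Phi b - Phi a = gauss_pdf c * (b - a).
Proof.
move=> ab; have [||c] := @MVT _ Phi gauss_pdf a b ab.
- by move=> x _; exact: is_derive_Phi.
- by apply: continuous_subspaceT => x; exact: continuous_Phi.
- by rewrite in_itv/=; exists c.
Qed.

Lemma Phi_lt a b : a < b -> Phi a < Phi b.
Proof.
move=> ab; have [c _ e] := Phi_mean_value ab.
by rewrite -subr_gt0 e mulr_gt0 ?gauss_pdf_gt0// subr_gt0.
Qed.

Lemma Phi_mono : {mono Phi : x y / x <= y}.
Proof. by apply: le_mono; exact: Phi_lt. Qed.

Lemma Phi_gt0 x : 0 < Phi x.
Proof. by apply: (le_lt_trans (Phi_ge0 (x - 1))); rewrite Phi_lt// ltrBlDr ltrDl. Qed.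

Lemma Phi_lt1 x : Phi x < 1.
Proof. by apply: (lt_le_trans _ (Phi_le1 (x + 1))); rewrite Phi_lt// ltrDl. Qed.

Lemma Phi_lip a b : `|Phi b - Phi a| <= gauss_pdf 0 * `|b - a|.
Proof.
apply: (mean_value_le is_derive_Phi) => t _.
by rewrite ger0_norm ?gauss_pdf_le// ltW// gauss_pdf_gt0.
Qed.

Lemma Phi_surj p : 0 < p < 1 -> exists z, Phi z = p.
Proof.
move=> /andP[p0 p1].
have [b pb] : exists b, p <= Phi b.
  have /fine_cvgP[_] := @cvg_cdfy1 _ _ _ _ (@of_measurableTypeR R : {RV normal_prob (0 : R) 1 >-> R}).
  move=> /cvgr_gt /(_ p p1) /=.
  move=> [M [_ H]]; exists (M + 1); apply/ltW/H; by rewrite ltrDl.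
have [a pa] : exists a, Phi a <= p.
  have /fine_cvgP[_] := @cvg_cdfNy0 _ _ _ _ (@of_measurableTypeR R : {RV normal_prob (0 : R) 1 >-> R}).
  move=> /cvgr_lt /(_ p p0) /=.
  move=> [M [_ H]]; exists (M - 1); apply/ltW/H; by rewrite ltrBlDr ltrDl.
have ab : a <= b by rewrite -Phi_mono (le_trans pa).
have [||c _ <-] := @IVT _ Phi a b p ab; last by exists c.
  by apply: continuous_subspaceT => x; exact: continuous_Phi.
by rewrite min_l ?max_r ?pa ?pb// Phi_mono.
Qed.

(** The default 0 is taken only outside the open unit interval, where [Phi z = p] has no
    solution. *)
Definition Phi_inv p : R := xget 0 [set z | Phi z = p].

Lemma Phi_invK p : 0 < p < 1 -> Phi (Phi_inv p) = p.
Proof.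
move=> p01; rewrite /Phi_inv; case: xgetP => //= h.
by have [z zp] := Phi_surj p01; have := h z; rewrite zp.
Qed.

Lemma Phi_inv_le p z : 0 < p < 1 -> (Phi_inv p <= z) = (p <= Phi z).
Proof. by move=> p01; rewrite -Phi_mono Phi_invK. Qed.

(** Dividing by the density at [u] makes the derivative in [x] equal to [exp (u x - x ^ 2 / 2)], so
    that the expansion at 0 starts with [x + u x ^ 2 / 2]. *)
Definition Phi_diff u x := (Phi u - Phi (u - x)) / gauss_pdf u.

(** The difference vanishes at [x = 0], and its derivative is [exp a - 1 - u t] with
    [a = u t - t ^ 2 / 2]. As [|a| <= 3/2 L |x|], the derivative is at most [2 a ^ 2 + t ^ 2 / 2],
    whence [5 = 2 (3/2) ^ 2 + 1/2]. *)
Lemma Phi_diff_taylor (L u x : R) : 1 <= L -> `|u| <= L -> L * `|x| <= 1 / 4 ->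
  `|Phi_diff u x - x - u * x ^+ 2 / 2| <= 5 * L ^+ 2 * `|x| ^+ 3.
Proof.
move=> L1 uL Lx.
pose h t := Phi_diff u t - t - u * t ^+ 2 / 2.
pose dh t := expR (u * t - t ^+ 2 / 2) - 1 - u * t.
have hd t : is_derive t (1 : R) h (dh t).
  have D0 : is_derive t (1 : R) (fun t => u - t) (-1).
    have : is_derive t (1 : R) (cst u - id) (0 - 1) by exact: is_deriveB.
    by rewrite sub0r.
  have D1 : is_derive t (1 : R) (fun t => Phi (u - t)) (gauss_pdf (u - t) * -1).
    exact: (@is_derive1_comp _ Phi (fun t => u - t) _ _ _ (is_derive_Phi _) D0).
  have D2 : is_derive t (1 : R)
      ((gauss_pdf u)^-1 *: (cst (Phi u) - (fun t => Phi (u - t))) - id -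
        (u / 2) *: (id ^+ 2))
     ((gauss_pdf u)^-1 *: (0 - gauss_pdf (u - t) * -1) - 1 - (u / 2) *: ((2%:R * t ^+ 1) *: 1)).
    exact: is_deriveB.
  have -> : h = (gauss_pdf u)^-1 *: (cst (Phi u) - (fun t => Phi (u - t))) - id - (u / 2) *: (id ^+ 2).
    apply/funext => y; rewrite /h /Phi_diff !fctE/= /GRing.scale/=.
    by rewrite mulrC [u / 2 * _]mulrAC.
  apply: is_derive_eq; rewrite /dh gauss_pdf_shift /GRing.scale/=.
  have g0 := gauss_pdf_gt0 u.
  have -> : t * u - t ^+ 2 / 2 = u * t - t ^+ 2 / 2 by rewrite mulrC.
  by field; rewrite gt_eqF.
rewrite -[leLHS](_ : `|h x - h 0| = _); last first.
  by rewrite /h /Phi_diff !subr0 subrr mul0r expr0n/= mulr0 mul0r !subr0.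
have -> : 5 * L ^+ 2 * `|x| ^+ 3 = 5 * L ^+ 2 * `|x| ^+ 2 * `|x - 0|.
  by rewrite subr0; ring.
apply: (mean_value_le hd) => t tx.
have {}tx : `|t| <= `|x|.
  have [x0|x0] := leP 0 x; move: tx.
    by rewrite min_l// max_r// => /andP[t0 tx]; rewrite !ger0_norm.
  move: x0 => /ltW x0; rewrite min_r// max_l// => /andP[xt t0].
  by rewrite !ler0_norm// lerN2.
have t0 := normr_ge0 t.
have x0 := normr_ge0 x.
have x14 : `|x| <= 1 / 4 by nra.
have t2 : t ^+ 2 = `|t| ^+ 2 by rewrite real_normK ?num_real.
set a := u * t - t ^+ 2 / 2.
have aL : `|a| <= 3 / 2 * (L * `|x|).
  rewrite (le_trans (ler_normB _ _))// normrM [X in _ + `|X|]mulrC normrM.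
  rewrite t2 (ger0_norm (_ : 0 <= 2^-1))// normrX normr_id.
  have : `|u| * `|t| <= L * `|x| by rewrite ler_pM.
  nra.
have a12 : `|a| <= 1 / 2 by rewrite (le_trans aL)//; lra.
have := expR_sub1D_le a12.
have -> : dh t = (expR a - 1 - a) - t ^+ 2 / 2 by rewrite /dh/a; field.
move=> ea; rewrite (le_trans (ler_normB _ _))// .
rewrite (ger0_norm (_ : 0 <= t ^+ 2 / 2)) ?divr_ge0 ?sqr_ge0//.
have : a ^+ 2 <= 9 / 4 * (L ^+ 2 * `|x| ^+ 2).
  rewrite -(real_normK (num_real a)).
  have := normr_ge0 a; nra.
rewrite t2.
have : `|t| ^+ 2 <= `|x| ^+ 2 by rewrite ler_sqr.
have : `|x| ^+ 2 <= L ^+ 2 * `|x| ^+ 2.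
  by rewrite ler_peMl ?sqr_ge0// expr_ge1// (le_trans _ L1).
lra.
Qed.

End Phi.

(** * Integration against the standard Gaussian measure on R^n *)

Section std_normal_integral.
Local Open Scope ereal_scope.
Context {R : realType}.

Definition rV_cons n (x : R) (v : 'rV[R]_n) : 'rV[R]_n.+1 := row_cons (x, v).

Definition rV_tail n (v : 'rV[R]_n.+1) : 'rV[R]_n := \row_j v ord0 (lift ord0 j).

Lemma rV_cons0 n x (v : 'rV[R]_n) : rV_cons x v ord0 ord0 = x.
Proof. by rewrite mxE unlift_none. Qed.

Lemma rV_consS n x (v : 'rV[R]_n) j : rV_cons x v ord0 (lift ord0 j) = v ord0 j.
Proof. by rewrite mxE liftK. Qed.

Lemma rV_consK n x (v : 'rV[R]_n) : rV_tail (rV_cons x v) = v.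
Proof. by apply/rowP => j; rewrite mxE rV_consS. Qed.

Lemma rV_consE n (v : 'rV[R]_n.+1) : v = rV_cons (v ord0 ord0) (rV_tail v).
Proof.
apply/rowP => i; case: (unliftP ord0 i) => [j|] ->; last by rewrite rV_cons0.
by rewrite rV_consS mxE.
Qed.

Lemma rV_consD n x y (v w : 'rV[R]_n) :
  (rV_cons x v + rV_cons y w = rV_cons (x + y) (v + w))%R.
Proof.
apply/rowP => i; rewrite mxE; case: (unliftP ord0 i) => [j|] ->.
  by rewrite !rV_consS mxE.
by rewrite !rV_cons0.
Qed.

Lemma rV_consZ n c x (v : 'rV[R]_n) :
  (c *: rV_cons x v = rV_cons (c * x) (c *: v))%R.
Proof.
apply/rowP => i; rewrite mxE; case: (unliftP ord0 i) => [j|] ->.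
  by rewrite !rV_consS mxE.
by rewrite !rV_cons0.
Qed.

Lemma rV0_eq (v w : 'rV[R]_0) : v = w.
Proof. by apply/rowP; case. Qed.

Lemma measurable_fun_rV_cons d (T : measurableType d) n (f : T -> R)
    (g : T -> 'rV[R]_n) : measurable_fun setT f -> measurable_fun setT g ->
  measurable_fun setT (fun t => rV_cons (f t) (g t)).
Proof.
move=> mf mg; apply/measurable_fun_rVP => i.
under eq_fun do rewrite mxE; case: unliftP => [j _|_] //=.
exact: (measurableT_comp (@measurable_coord _ _ _ j)).
Qed.

Lemma measurable_fun_coord d (T : measurableType d) n (f : T -> 'rV[R]_n) i :
  measurable_fun setT f -> measurable_fun setT (fun t => f t ord0 i).
Proof. by move=> mf; exact: (measurableT_comp (@measurable_coord _ _ _ i)). Qed.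

Lemma measurable_fun_rV_tail d (T : measurableType d) n (f : T -> 'rV[R]_n.+1) :
  measurable_fun setT f -> measurable_fun setT (fun t => rV_tail (f t)).
Proof.
move=> mf; apply/measurable_fun_rVP => i.
under eq_fun do rewrite mxE; exact: measurable_fun_coord.
Qed.

Lemma measurable_fun_rVD d (T : measurableType d) n (f g : T -> 'rV[R]_n) :
  measurable_fun setT f -> measurable_fun setT g ->
  measurable_fun setT (fun t => f t + g t)%R.
Proof.
move=> mf mg; apply/measurable_fun_rVP => i.
by under eq_fun do rewrite mxE; apply: measurable_funD; exact: measurable_fun_coord.
Qed.

Lemma measurable_fun_rVZ d (T : measurableType d) n (c : R) (f : T -> 'rV[R]_n) :
  measurable_fun setT f -> measurable_fun setT (fun t => c *: f t)%R.
Proof.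
move=> mf; apply/measurable_fun_rVP => i.
by under eq_fun do rewrite mxE; apply: measurable_funM => //; exact: measurable_fun_coord.
Qed.

Lemma ge0_integral_std_normalS n (f : 'rV[R]_n.+1 -> \bar R) :
    measurable_fun setT f -> (forall x, 0 <= f x) ->
  \int[std_normal R n.+1]_v f v =
  \int[gauss]_x \int[std_normal R n]_v f (rV_cons x v).
Proof.
move=> mf f0.
rewrite ge0_integral_gauss; last 2 first.
- apply: (@measurable_fun_fubini_tonelli_F _ _ _ _ _ (std_normal R n)
    (fun p => f (rV_cons p.1 p.2))) => //.
  apply: measurableT_comp => //; exact: measurable_fun_rV_cons.
- by move=> x; exact: integral_ge0.
rewrite -(fubini_tonelli1 (fun p : measurableTypeR R * 'rV[R]_n => f (row_cons p)))//.
  by rewrite /= ge0_integral_distribution.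
by apply: measurableT_comp => //; exact: measurable_row_cons.
Qed.

Lemma measurable_fun_integral d1 d2 (T1 : measurableType d1)
    (T2 : measurableType d2) (m : {sigma_finite_measure set T2 -> \bar R})
    (f : T1 -> T2 -> \bar R) :
  measurable_fun setT (fun p : T1 * T2 => f p.1 p.2) ->
  (forall x y, 0 <= f x y) ->
  measurable_fun setT (fun x => \int[m]_y f x y).
Proof.
move=> mf f0.
exact: (@measurable_fun_fubini_tonelli_F _ _ _ _ _ m (fun p => f p.1 p.2)).
Qed.

Lemma ge0_integral_swap d1 d2 (T1 : measurableType d1) (T2 : measurableType d2)
    (m1 : {sigma_finite_measure set T1 -> \bar R})
    (m2 : {sigma_finite_measure set T2 -> \bar R}) (f : T1 -> T2 -> \bar R) :
  measurable_fun setT (fun p : T1 * T2 => f p.1 p.2) ->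
  (forall x y, 0 <= f x y) ->
  \int[m1]_x \int[m2]_y f x y = \int[m2]_y \int[m1]_x f x y.
Proof.
move=> mf f0; exact: (@fubini_tonelli _ _ _ _ _ m1 m2 (fun p => f p.1 p.2)).
Qed.

(** The Cameron-Martin density of N(a, I) relative to N(0, I), at [z]. *)
Definition tilt n (a z : 'rV[R]_n) : R :=
  expR (\sum_i (a ord0 i * z ord0 i - a ord0 i ^+ 2 / 2))%R.

Lemma tilt_cons n (a : 'rV[R]_n.+1) x v :
  (tilt a (rV_cons x v) =
   expR (a ord0 ord0 * x - a ord0 ord0 ^+ 2 / 2) * tilt (rV_tail a) v)%R.
Proof.
rewrite /tilt big_ord_recl rV_cons0 expRD; congr (_ * expR _)%R.
by apply: eq_bigr => j _; rewrite rV_consS !mxE.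
Qed.

Lemma measurable_fun_tilt d (T : measurableType d) n (f g : T -> 'rV[R]_n) :
  measurable_fun setT f -> measurable_fun setT g ->
  measurable_fun setT (fun t => tilt (f t) (g t)).
Proof.
move=> mf mg; apply: measurableT_comp => //; apply: measurable_sum => i.
apply: measurable_funB; apply: measurable_funM => //.
- exact: measurable_fun_coord.
- exact: measurable_fun_coord.
- by apply: measurable_funX; exact: measurable_fun_coord.
Qed.

Lemma tilt_gt0 n (a z : 'rV[R]_n) : (0 < tilt a z)%R.
Proof. exact: expR_gt0. Qed.

(** The Cameron-Martin formula on R^n, from the one on the line: both the Gaussian measure and
    [tilt] factor over the first coordinate and the tail. *)
Lemma ge0_integral_std_normal_shift n (a : 'rV[R]_n) (f : 'rV[R]_n -> \bar R) :
    measurable_fun setT f -> (forall x, 0 <= f x) ->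
  \int[std_normal R n]_z f (z + a)%R =
  \int[std_normal R n]_z (f z * (tilt a z)%:E).
Proof.
elim: n a f => [|n IH] a f mf f0.
  apply: eq_integral => z _; rewrite (rV0_eq (z + a)%R z) /tilt big_ord0 expR0.
  by rewrite mule1.
have mshift m (b : 'rV[R]_m) (g : 'rV[R]_m -> \bar R) :
    measurable_fun setT g -> measurable_fun setT (fun z : 'rV[R]_m => g (z + b)%R).
  by move=> mg; apply: (measurableT_comp mg); exact: measurable_fun_rVD.
have mt m (b : 'rV[R]_m) : measurable_fun setT (fun z => (tilt b z)%:E).
  by apply/measurable_EFinP; exact: measurable_fun_tilt.
have t0 m (b z : 'rV[R]_m) : 0 <= (tilt b z)%:E by rewrite lee_fin ltW ?tilt_gt0.
rewrite ge0_integral_std_normalS//; last exact: mshift.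
rewrite ge0_integral_std_normalS//; last 2 first.
- by apply: emeasurable_funM => //; exact: mt.
- by move=> x; rewrite mule_ge0.
pose g x := \int[std_normal R n]_v (f (rV_cons x v) * (tilt (rV_tail a) v)%:E).
have mfc x : measurable_fun setT (fun v : 'rV[R]_n => f (rV_cons x v)).
  by apply: (measurableT_comp mf); exact: measurable_fun_rV_cons.
transitivity (\int[gauss]_x g (x + a ord0 ord0)%R).
  apply: eq_integral => x _; rewrite /g -IH//.
  by apply: eq_integral => v _; rewrite {1}(rV_consE a) rV_consD.
rewrite ge0_integral_gauss_shift.
- apply: eq_integral => x _; rewrite /g -ge0_integralZr//.
  + by apply: eq_integral => v _; rewrite tilt_cons -muleA -EFinM [in LHS]mulrC.
  + by apply: emeasurable_funM => //; exact: mt.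
  + by move=> v _; rewrite mule_ge0.
- apply: measurable_fun_integral; last by move=> x v; rewrite mule_ge0.
  apply: emeasurable_funM.
    by apply: (measurableT_comp mf); exact: measurable_fun_rV_cons.
  by apply/measurable_EFinP; exact: measurable_fun_tilt.
- by move=> x; apply: integral_ge0 => v _; rewrite mule_ge0.
Qed.

Lemma integral_std_normal_expR_norm n (i : 'I_n) :
  \int[std_normal R n]_z (expR `|z ord0 i|)%:E <= 4%:E.
Proof.
elim: n i => [[]//|n IH] i.
have me m (j : 'I_m) : measurable_fun setT (fun z : 'rV[R]_m => (expR `|z ord0 j|)%:E).
  apply/measurable_EFinP; do 2 apply: measurableT_comp => //.
  exact: measurable_coord.
rewrite ge0_integral_std_normalS//.
case: (unliftP ord0 i) => [j|] ->.
  under eq_integral do under eq_integral do rewrite rV_consS.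
  by rewrite integral_cst//= probability_setT mule1; exact: IH.
under eq_integral do under eq_integral do rewrite rV_cons0.
under eq_integral do rewrite integral_cst//= probability_setT mule1.
exact: integral_gauss_expR_norm.
Qed.

End std_normal_integral.

(** * Finite measures with the same distribution function *)

Section finite_measure_cdf.
Local Open Scope ereal_scope.
Context {R : realType}.

(** Finiteness allows half-lines to be subtracted, which gives the half-open intervals; these are
    closed under intersection and generate the sigma-algebra. *)
Lemma finite_measure_cdf_unique (m1 m2 : {measure set R -> \bar R}) :
  m1 setT < +oo -> (forall x : R, m1 `]-oo, x]%classic = m2 `]-oo, x]%classic) ->
  forall A, measurable A -> m1 A = m2 A.
Proof.
move=> m1oo m12 A mA.
have m1fin (B : set R) : measurable B -> m1 B < +oo.
  by move=> mB; apply: le_lt_trans m1oo; apply: le_measure => //; rewrite inE.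
have m12oc (a b : R) : m1 `]a, b]%classic = m2 `]a, b]%classic.
  have [ab|ba] := leP a b; last first.
    by rewrite set_itv_ge ?measure0// bnd_simp -leNgt ltW.
  have -> : `]a, b]%classic = `]-oo, b] `\` `]-oo, a] :> set R.
    by rewrite -[RHS]setCK setCD setCitvl setUC -[LHS]setCK setCitv.
  have ab' : `]-oo, b]%classic `&` `]-oo, a]%classic = `]-oo, a]%classic :> set R.
    by rewrite setIidr//; exact: subset_itvl.
  have b1 : m1 `]-oo, b]%classic < +oo by exact: m1fin.
  have b2 : m2 `]-oo, b]%classic < +oo by rewrite -m12.
  rewrite (measureD _ _ b1)// (measureD _ _ b2)// !ab'.
  by congr (_ - _); exact: m12.
apply: (measure_unique (@ocitv R) (fun n => `](- n%:R)%R, n%:R]%classic)) => //.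
- exact: ocitvI.
- by move=> n; exact: is_ocitv.
- apply/seteqP; split=> // x _.
  have [n xn] : exists n : nat, (`|x| < n%:R)%R.
    by exists (Num.truncn `|x|).+1; exact: truncnS_gt.
  exists n => //=; rewrite in_itv/=; move: xn.
  by rewrite ltr_norml => /andP[-> /ltW].
- by move=> B [[a b] _ <-].
- by move=> n; exact: m1fin.
Qed.

End finite_measure_cdf.

(** * Expectations of bounded functions *)

Section bounded_expectation.
Context d (T : measurableType d) (R : realType) (P : probability T R).

Lemma bounded_integrable (f : T -> R) (M : R) : measurable_fun setT f ->
  (forall x, `|f x| <= M) -> P.-integrable setT (EFin \o f).
Proof.
move=> mf fM; apply: measurable_bounded_integrable => //.
  exact: (le_lt_trans (probability_le1 P measurableT) (ltry _)).
exists M; split; first exact: num_real.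
by move=> N MN x _; exact: le_trans (fM x) (ltW MN).
Qed.

Lemma EFin_Rintegral (f : T -> R) : P.-integrable setT (EFin \o f) ->
  ((\int[P]_x f x)%R)%:E = (\int[P]_x (f x)%:E)%E.
Proof. by move=> fi; rewrite /Rintegral fineK//; exact: integrable_fin_num. Qed.

Lemma Rintegral_probability_cst (c : R) : \int[P]_x c = c.
Proof.
rewrite Rintegral_cst// [X in fine X](_ : _ = 1%E) ?mulr1//.
exact: probability_setT.
Qed.

Lemma Rintegral_sum (I : Type) (r : seq I) (f : I -> T -> R) :
  (forall i, P.-integrable setT (EFin \o f i)) ->
  \int[P]_x (\sum_(i <- r) f i x) = \sum_(i <- r) \int[P]_x f i x.
Proof.
move=> fi; suff [] : \int[P]_x (\sum_(i <- r) f i x) = \sum_(i <- r) \int[P]_x f i x /\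
  P.-integrable setT (EFin \o (fun x => \sum_(i <- r) f i x)) by [].
elim: r => [|i r [IH1 IH2]].
  rewrite big_nil; under [EFin \o _]eq_fun do rewrite big_nil.
  under eq_Rintegral do rewrite big_nil.
  by rewrite Rintegral_probability_cst; split => //; exact: integrable0.
rewrite big_cons; under [EFin \o _]eq_fun do rewrite big_cons.
under eq_Rintegral do rewrite big_cons.
by rewrite RintegralD// IH1; split => //; have := integrableD measurableT (fi i) IH2.
Qed.

End bounded_expectation.

(** * Monotone transport of a weighted mixture of Gaussians *)

Section weighted_transport.
Context d d' (T : measurableType d) (V : measurableType d') (R : realType).
Variables (P : probability T R) (X0 : T -> R) (beta s : R) (rho : V -> T -> R).
Hypotheses (mX0 : measurable_fun setT X0) (X0b : forall w, `|X0 w| <= beta).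
Hypotheses (s0 : 0 < s).
Hypothesis mrho : measurable_fun setT (fun p : V * T => rho p.1 p.2).
Hypothesis rhob : forall v, exists2 K, 0 < K & forall w, K^-1 <= rho v w <= K.

(** The quotient [weighted_cdf v / weight v] is the distribution function of [X0 + s Z], with [Z]
    standard normal and independent, when [P] is reweighted by [rho v]. The parameter [v] will hold
    the other coordinates; it stays a variable because joint measurability in [(y, v)] is
    required. *)
Definition weight v : R := (\int[P]_w rho v w)%R.
Definition weighted_cdf v y : R := (\int[P]_w (rho v w * Phi ((y - X0 w) / s)))%R.
Definition weighted_transport (p : R * V) : R :=
  Phi_inv (weighted_cdf p.2 p.1 / weight p.2).

Let mrhov v : measurable_fun setT (rho v).
Proof. exact: (measurableT_comp mrho (measurable_pair1 v)). Qed.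

Let rho_gt0 v w : 0 < rho v w.
Proof.
by have [K K0 /(_ w)/andP[h _]] := rhob v; apply: lt_le_trans h; rewrite invr_gt0.
Qed.

Let irho v (f : T -> R) (M : R) : measurable_fun setT f ->
  (forall w, `|f w| <= M) -> P.-integrable setT (EFin \o (fun w => rho v w * f w)).
Proof.
move=> mf fM; have [K K0 rK] := rhob v.
apply: (@bounded_integrable _ _ _ _ _ (K * M)); first exact: measurable_funM.
move=> w; rewrite normrM ler_pM// gtr0_norm//.
by have /andP[] := rK w.
Qed.

Let irho1 v : P.-integrable setT (EFin \o rho v).
Proof.
have := @irho v (cst 1) 1 (measurable_cst _); rewrite (_ : _ \o _ = EFin \o rho v).
  by apply => w /=; rewrite normr1.
by apply/funext => w /=; rewrite mulr1.
Qed.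

Lemma weight_gt0 v : 0 < weight v.
Proof.
have [K K0 rK] := rhob v.
have : \int[P]_w K^-1 <= weight v.
  apply: le_Rintegral => //.
  - apply: (@bounded_integrable _ _ _ _ _ `|K^-1|) => //.
  - by move=> w _; have /andP[] := rK w.
by rewrite Rintegral_probability_cst; apply: lt_le_trans; rewrite invr_gt0.
Qed.

Let mPhi y : measurable_fun setT (fun w => Phi ((y - X0 w) / s)).
Proof.
apply: (measurableT_comp measurable_Phi).
by apply: measurable_funM => //; exact: measurable_funB.
Qed.

Let Phi_norm x : `|Phi x| <= 1 :> R.
Proof. by rewrite ger0_norm ?Phi_le1 ?Phi_ge0. Qed.

Let icdf v y : P.-integrable setT (EFin \o (fun w => rho v w * Phi ((y - X0 w) / s))).
Proof. exact: (@irho v _ 1). Qed.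

Let weighted_cdf_const v c : \int[P]_w (rho v w * c) = weight v * c.
Proof. exact: RintegralZr. Qed.

Let iconst v c : P.-integrable setT (EFin \o (fun w => rho v w * c)).
Proof. by apply: (@irho v _ `|c|). Qed.

(** A shift by [X0] moves the argument by at most [beta]. The sandwich keeps the quotient strictly
    inside (0, 1) and locates its quantiles. *)
Lemma weighted_cdf_bounds v y :
  weight v * Phi ((y - beta) / s) <= weighted_cdf v y <= weight v * Phi ((y + beta) / s).
Proof.
rewrite -!weighted_cdf_const; apply/andP; split; apply: le_Rintegral => // w _;
  rewrite ler_pM2l// Phi_mono ler_pM2r ?invr_gt0//;
  have := X0b w; rewrite ler_norml => /andP[]; lra.
Qed.

Lemma weighted_cdf_in01 v y : 0 < weighted_cdf v y / weight v < 1.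
Proof.
have /andP[l u] := weighted_cdf_bounds v y; have W0 := weight_gt0 v.
rewrite divr_gt0//=; last by rewrite (lt_le_trans _ l)// mulr_gt0// Phi_gt0.
by rewrite ltr_pdivrMr// mul1r (le_lt_trans u)// gtr_pMr// Phi_lt1.
Qed.

Lemma weighted_cdf_lt v y z : y < z -> weighted_cdf v y < weighted_cdf v z.
Proof.
move=> yz; have [K K0 rK] := rhob v.
(* [M] bounds every mean value point below uniformly in [w], so the increment of [Phi] has a
   positive lower bound that survives integration. *)
pose M : R := (`|y| + `|z| + beta) / s.
have M0 : 0 < gauss_pdf M * ((z - y) / s).
  by rewrite mulr_gt0 ?gauss_pdf_gt0// divr_gt0// subr_gt0.
have : \int[P]_w (rho v w * (gauss_pdf M * ((z - y) / s))) <=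
    weighted_cdf v z - weighted_cdf v y.
  rewrite /weighted_cdf -RintegralB//; apply: le_Rintegral => //.
    by have := integrableB measurableT (icdf v z) (icdf v y).
  move=> w _; rewrite -mulrBr ler_pM2l//.
  have h : (y - X0 w) / s < (z - X0 w) / s by rewrite ltr_pM2r ?invr_gt0// ltrD2r.
  have [c /andP[c1 c2] ->] := Phi_mean_value h.
  rewrite -mulrBl (_ : z - X0 w - (y - X0 w) = z - y); last by ring.
  rewrite ler_pM2r; last by rewrite divr_gt0// subr_gt0.
  rewrite gauss_pdfE [leRHS]gauss_pdfE ler_pM2l ?gauss_pdf_gt0// ler_expR lerN2.
  rewrite ler_pM2r// -(real_normK (num_real c)) ler_sqr ?nnegrE//; last first.
    by rewrite divr_ge0 ?addr_ge0 ?normr_ge0 ?(le_trans _ (X0b w))// ltW.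
  have := X0b w; have := ler_norm z; have := ler_norm (- y); have := normr_ge0 y.
  have := normr_ge0 z.
  rewrite normrN !ler_norml => z0 y0 hy hz /andP[x1 x2].
  apply/andP; split; last first.
    by apply/ltW/(lt_le_trans c2); rewrite ler_pM2r ?invr_gt0//; lra.
  apply/ltW/(le_lt_trans _ c1); rewrite -mulNr ler_pM2r ?invr_gt0//; lra.
rewrite weighted_cdf_const => h; rewrite -subr_gt0; apply: lt_le_trans h.
by rewrite mulr_gt0// weight_gt0.
Qed.

Lemma weighted_cdf_mono v : {mono weighted_cdf v : y z / y <= z}.
Proof. by apply: le_mono; exact: weighted_cdf_lt. Qed.

Lemma continuous_weighted_cdf v : continuous (weighted_cdf v).
Proof.
have [C C0 lip] : exists2 C : R, 0 < C & forall y z,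
    `|weighted_cdf v y - weighted_cdf v z| <= C * `|y - z|.
  exists (weight v * (gauss_pdf 0 / s)).
    by rewrite mulr_gt0 ?weight_gt0// divr_gt0 ?gauss_pdf_gt0.
  move=> y z; rewrite /weighted_cdf -RintegralB//.
  have ib := integrableB measurableT (icdf v y) (icdf v z).
  rewrite (le_trans (le_normr_Rintegral measurableT ib))//.
  rewrite -mulrA -weighted_cdf_const; apply: le_Rintegral => //.
    by apply: integrable_norm.
  move=> w _; rewrite -mulrBr normrM gtr0_norm// ler_pM2l//.
  rewrite (le_trans (Phi_lip _ _))// -mulrA ler_pM2l ?gauss_pdf_gt0//.
  rewrite -mulrBl normrM (gtr0_norm (_ : 0 < s^-1)) ?invr_gt0// mulrC.
  by rewrite (_ : y - X0 w - (z - X0 w) = y - z)//; ring.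
move=> y; apply/cvgrPdist_lt => e e0; near=> z.
rewrite (le_lt_trans (lip _ _))// -ltr_pdivlMl//.
near: z; apply: cvgr_dist_lt => //; by rewrite mulr_gt0// invr_gt0.
Unshelve. all: by end_near. Qed.

Lemma weighted_cdf_quantile v p : 0 < p < 1 ->
  exists y, weighted_cdf v y = weight v * p.
Proof.
move=> p01; have [z <-] := Phi_surj p01.
have b0 : 0 <= beta.
  by have /andP[l u] := weighted_cdf_bounds v 0; move: (le_trans l u);
    rewrite ler_pM2l ?weight_gt0// Phi_mono ler_pM2r ?invr_gt0//; lra.
(* By [weighted_cdf_bounds], the values at these two endpoints enclose [weight v * Phi z]. *)
have ab : s * z - beta <= s * z + beta by lra.
have [||c _ <-] := @IVT _ (weighted_cdf v) _ _ (weight v * Phi z) ab; last by exists c.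
  by apply: continuous_subspaceT => x; exact: continuous_weighted_cdf.
have szs : s * z / s = z by rewrite mulrAC divff ?mul1r// gt_eqF.
rewrite min_l ?max_r ?weighted_cdf_mono//.
have /andP[_ u] := weighted_cdf_bounds v (s * z - beta).
have /andP[l _] := weighted_cdf_bounds v (s * z + beta).
by move: u l; rewrite subrK addrK szs => -> ->.
Qed.

Lemma Phi_weighted_transport y v :
  weight v * Phi (weighted_transport (y, v)) = weighted_cdf v y.
Proof.
rewrite Phi_invK ?weighted_cdf_in01//= mulrC divfK// gt_eqF//; exact: weight_gt0.
Qed.

Lemma weighted_transport_le y v z :
  (weighted_transport (y, v) <= z) = (weighted_cdf v y <= weight v * Phi z).
Proof.
by rewrite Phi_inv_le ?weighted_cdf_in01// ler_pdivrMr ?weight_gt0// mulrC.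
Qed.

Lemma measurable_weight : measurable_fun setT weight.
Proof.
apply/measurable_EFinP.
rewrite (_ : EFin \o _ = fun v => (\int[P]_w (rho v w)%:E)%E); last first.
  by apply/funext => v; rewrite /= EFin_Rintegral.
apply: measurable_fun_integral; first exact/measurable_EFinP.
by move=> v w; rewrite lee_fin ltW.
Qed.

Lemma measurable_weighted_cdf :
  measurable_fun setT (fun p : R * V => weighted_cdf p.2 p.1).
Proof.
apply/measurable_EFinP.
rewrite (_ : EFin \o _ = fun p : R * V =>
    (\int[P]_w (rho p.2 w * Phi ((p.1 - X0 w) / s))%:E)%E); last first.
  by apply/funext => v; rewrite /= EFin_Rintegral.
apply: measurable_fun_integral; last first.
  by move=> v w; rewrite lee_fin mulr_ge0 ?Phi_ge0 ?ltW.
apply/measurable_EFinP; apply: measurable_funM => /=.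
  apply: (measurableT_comp mrho (_ : measurable_fun setT (fun q : R * V * T => (q.1.2, q.2)))).
  by apply: measurable_fun_pair => //=; exact: measurableT_comp.
apply: (measurableT_comp measurable_Phi); apply: measurable_funM => //.
by apply: measurable_funB; exact: measurableT_comp.
Qed.

(** By [weighted_transport_le], the preimage of an open half-line is the set where one measurable
    function of [(y, v)] exceeds another. *)
Lemma measurable_weighted_transport : measurable_fun setT weighted_transport.
Proof.
apply: (measurability _ (RGenOInfty.measurableE R)) => _ [_ [z ->] <-].
rewrite setTI (_ : _ @^-1` _ =
    (fun p => weight p.2 * Phi z < weighted_cdf p.2 p.1) @^-1` [set true]).
  rewrite -[X in measurable X]setTI; apply: measurable_fun_ltr => //.
    by apply: measurable_funM => //; apply: (measurableT_comp measurable_weight).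
  exact: measurable_weighted_cdf.
by apply/seteqP; split=> -[y v] /=; rewrite in_itv/= andbT !ltNge weighted_transport_le.
Qed.

(** Each side is an integral of [f] against a finite measure on the line, [m1] and [m2] below, and
    these agree on half-lines because the transport is monotone in its first argument. *)
Lemma ge0_integral_weighted_transport v (f : R -> \bar R) :
    measurable_fun setT f -> (forall x, 0 <= f x)%E ->
  (\int[P]_w ((rho v w)%:E * \int[gauss]_x f (weighted_transport ((X0 w + s * x)%R, v))) =
   (weight v)%:E * \int[gauss]_x f x)%E.
Proof.
pose g (p : T * R) := weighted_transport (X0 p.1 + s * p.2, v).
have mg : measurable_fun setT g.
  apply: (measurableT_comp measurable_weighted_transport).
  apply: measurable_fun_pair => //=; apply: measurable_funD.
    exact: measurableT_comp.
  exact: measurable_funM.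
pose g' : {mfun (T * R)%type >-> R} := HB.pack g (isMeasurableFun.Build _ _ _ _ _ mg).
have mr : measurable_fun setT (fun p : T * R => rho v p.1) by exact: measurableT_comp.
have r0 (p : T * R) : 0 <= rho v p.1 by exact: ltW.
have mW : measurable_fun setT (cst (weight v) : R -> R) by [].
have W0 (x : R) : 0 <= cst (weight v) x by exact/ltW/weight_gt0.
pose m1 := pushforward (mdensity (P \x gauss)%E mr r0) g'.
pose m2 := mdensity gauss mW W0.
have E1 (h : R -> \bar R) : measurable_fun setT h -> (forall x, 0 <= h x)%E ->
  (\int[m1]_x h x = \int[P]_w ((rho v w)%:E * \int[gauss]_x h (g (w, x))))%E.
  move=> mh h0.
  have mhg : measurable_fun setT (fun p => h (g p)) by exact: measurableT_comp.
  rewrite /m1 ge0_integral_pushforward// ge0_integral_mdensity//; last first.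
    by move=> p; exact: h0.
  rewrite fubini_tonelli1//; last 2 first.
  - by apply: emeasurable_funM => //; exact/measurable_EFinP.
  - by move=> p; apply: mule_ge0; [exact: h0|rewrite lee_fin; exact: r0].
  apply: eq_integral => w _; rewrite /fubini_F/= ge0_integralZr//.
  - by rewrite muleC.
  - exact: (measurableT_comp mhg (measurable_pair1 w)).
  - by rewrite lee_fin ltW.
have m1E A : measurable A ->
    (m1 A = \int[P]_w ((rho v w)%:E * gauss ((fun x => g (w, x)) @^-1` A)))%E.
  move=> mA; have <- : (\int[m1]_x (\1_A x)%:E)%E = m1 A by rewrite integral_indic// setIT.
  rewrite E1//; last first.
    by apply/measurable_EFinP; exact: measurable_indic.
  apply: eq_integral => w _; congr (_ * _)%E.
  have mgw : measurable_fun setT (fun x => g (w, x)).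
    exact: (measurableT_comp mg (measurable_pair1 w)).
  rewrite -[X in _ = gauss X]setIT -integral_indic//.
  by rewrite -[X in measurable X]setTI; exact: mgw.
move=> mf f0; rewrite -(E1 f)//.
have -> : (\int[m1]_x f x = \int[m2]_x f x)%E.
  apply: eq_measure_integral => A mA _; apply: finite_measure_cdf_unique mA.
    apply: (eq_ind_r (fun t => (t < +oo)%E) _ (m1E _ measurableT)).
    under eq_integral do rewrite preimage_setT probability_setT mule1.
    by rewrite -EFin_Rintegral// ltry.
  move=> z; apply: (etrans (m1E _ _)) => //.
  have z01 : 0 < Phi z < 1 by rewrite Phi_gt0 Phi_lt1.
  (* For this quantile [y], the transport is at most [z] exactly when [X0 w + s * x <= y], an event
     of Gaussian measure [Phi ((y - X0 w) / s)]. *)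
  have [y yz] := weighted_cdf_quantile v z01.
  transitivity (\int[P]_w (rho v w * Phi ((y - X0 w) / s))%:E)%E.
    apply: eq_integral => w _; rewrite EFinM -gauss_itvE; congr (_ * gauss _)%E.
    apply/seteqP; split=> x /=; rewrite !in_itv/= /g weighted_transport_le -yz weighted_cdf_mono.
      by rewrite ler_pdivlMr// lerBrDl mulrC.
    by rewrite ler_pdivlMr// lerBrDl mulrC.
  rewrite -EFin_Rintegral// [LHS](_ : _ = (weighted_cdf v y)%:E)// yz EFinM -gauss_itvE.
  by apply/esym; apply: (integral_cst gauss _ (weight v)%:E).
rewrite /m2 ge0_integral_mdensity//.
rewrite [LHS](_ : _ = \int[gauss]_x (f x * (weight v)%:E))%E// ge0_integralZr//.
  by rewrite muleC.
by rewrite lee_fin ltW// weight_gt0.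
Qed.

End weighted_transport.

(** * Third-order error of the monotone transport *)

Section transport_error.
Context {R : realType}.

(* Third-order expansion of [expR b * (Phi_diff u (e x) - u e^2 / 2)]: what is
   left besides the error has mean zero once the first two moments match. *)
Lemma tilted_taylor (B L e u x S Q : R) :
  1 <= B -> 1 <= L -> 0 < e -> 8 * B * (L * e) <= 1 ->
  `|u| <= L -> `|x| <= B -> `|S| <= L * B -> 0 <= Q <= B ->
  let rho := expR (e * S - e ^+ 2 * Q) in
  [/\ 1 / 2 <= rho, rho <= 3 / 2 &
  `|rho * (Phi_diff u (e * x) - u * e ^+ 2 / 2) -
    (e * x + e ^+ 2 * (S * x) + u * e ^+ 2 / 2 * (x ^+ 2 - 1))|
  <= 23 * B ^+ 3 * (L ^+ 2 * e ^+ 3)].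
Proof.
move=> B1 L1 e0 BLe uL xB SL /andP[Q0 QB] rho.
set b := e * S - e ^+ 2 * Q in rho *.
have Le0 : 0 < L * e by rewrite mulr_gt0 // (lt_le_trans _ L1).
have eLe : e <= L * e by rewrite ler_peMl // ltW.
have Le1 : L * e <= 1 / 8 by nra.
have bB : `|b| <= 2 * (B * (L * e)).
  rewrite (le_trans (ler_normB _ _))// normrM (gtr0_norm e0).
  rewrite (ger0_norm (mulr_ge0 (sqr_ge0 e) Q0)).
  have h1 : e * `|S| <= B * (L * e) by nra.
  have h2 : e ^+ 2 * Q <= B * (L * e).
    rewrite mulrC ler_pM ?sqr_ge0//; nra.
  lra.
have b12 : `|b| <= 1 / 2 by rewrite (le_trans bB)//; nra.
have r1 := expR_sub1_le b12.
have r2 := expR_sub1D_le b12.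
rewrite -/rho in r1 r2.
have rho1 : `|rho - 1| <= 4 * (B * (L * e)) by lra.
have rho12 : `|rho - 1| <= 1 / 2 by rewrite (le_trans rho1)//; nra.
have rhob : 1 / 2 <= rho <= 3 / 2.
  by move: rho12; rewrite ler_norml => /andP[? ?]; apply/andP; split; lra.
have /andP[rhol rhou] := rhob; split=> //.
have ex : `|e * x| <= e * B by rewrite normrM (gtr0_norm e0) ler_pM2l.
have Lex : L * `|e * x| <= 1 / 4.
  by rewrite (@le_trans _ _ (L * (e * B))) ?ler_pM2l// ?(lt_le_trans _ L1)//; nra.
have tay := Phi_diff_taylor L1 uL Lex.
set D := Phi_diff u (e * x) in tay *.
set t1 := D - e * x - u * (e * x) ^+ 2 / 2 in tay.
set t2 := rho - 1 - b in r2.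
(* Insert [D = t1 + e x + u (e x) ^ 2 / 2] and [rho = 1 + b + t2]. Four third-order terms remain,
   with constants 10, 8, 1 and 2. *)
have -> : rho * (D - u * e ^+ 2 / 2) -
    (e * x + e ^+ 2 * (S * x) + u * e ^+ 2 / 2 * (x ^+ 2 - 1)) =
  rho * t1 + e * x * t2 - e ^+ 3 * (Q * x) +
  (rho - 1) * (u * e ^+ 2 / 2 * (x ^+ 2 - 1)).
  by rewrite /t1 /t2 /b; field.
have B0 : 0 < B by exact: lt_le_trans B1.
have L0 : 0 < L by exact: lt_le_trans L1.
have e2 : 0 < e ^+ 2 by rewrite exprn_gt0.
have e3 : 0 < e ^+ 3 by rewrite exprn_gt0.
have M0 : 0 < L ^+ 2 * e ^+ 3 by rewrite mulr_gt0 // exprn_gt0.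
have B3 : 0 < B ^+ 3 by rewrite exprn_gt0.
have B23 : B ^+ 2 <= B ^+ 3 by rewrite [leRHS]exprSr ler_peMr// exprn_ge0// ltW.
have e3M : e ^+ 3 <= L ^+ 2 * e ^+ 3 by rewrite ler_peMl ?(ltW e3)// exprn_ege1.
have n1 : `|rho * t1| <= 10 * B ^+ 3 * (L ^+ 2 * e ^+ 3).
  rewrite normrM (ger0_norm (_ : 0 <= rho)); last lra.
  have : `|t1| <= 5 * B ^+ 3 * (L ^+ 2 * e ^+ 3).
    rewrite (le_trans tay)//.
    have : `|e * x| ^+ 3 <= (e * B) ^+ 3 by rewrite lerXn2r ?nnegrE ?mulr_ge0 ?(ltW e0) ?(ltW B0).
    move=> /(ler_wpM2l (mulr_ge0 (ler0n _ 5) (sqr_ge0 L))) h.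
    rewrite (le_trans h)//.
    by rewrite le_eqVlt; apply/orP; left; apply/eqP; ring.
  have : 0 <= `|t1| by [].
  nra.
have n2 : `|e * x * t2| <= 8 * B ^+ 3 * (L ^+ 2 * e ^+ 3).
  have t2B : `|t2| <= 8 * (B * (L * e)) ^+ 2.
    rewrite (le_trans r2)// -(real_normK (num_real b)).
    have : `|b| ^+ 2 <= (2 * (B * (L * e))) ^+ 2.
      by rewrite lerXn2r ?nnegrE// (le_trans _ bB).
    by rewrite exprMn; lra.
  rewrite normrM (le_trans (ler_pM _ _ ex t2B))//.
  by rewrite le_eqVlt; apply/orP; left; apply/eqP; ring.
have n3 : `|e ^+ 3 * (Q * x)| <= B ^+ 3 * (L ^+ 2 * e ^+ 3).
  rewrite normrM (gtr0_norm e3) normrM (ger0_norm Q0).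
  have h1 : Q * `|x| <= B ^+ 2 by rewrite expr2 ler_pM.
  rewrite [leLHS]mulrC; apply: ler_pM; [by rewrite mulr_ge0|exact: ltW| |exact: e3M].
  exact: le_trans h1 B23.
have n4 : `|(rho - 1) * (u * e ^+ 2 / 2 * (x ^+ 2 - 1))| <= 2 * B ^+ 3 * (L ^+ 2 * e ^+ 3).
  have x2 : `|x ^+ 2 - 1| <= B ^+ 2.
    have := sqr_ge0 x; have : x ^+ 2 <= B ^+ 2.
      by rewrite -(real_normK (num_real x)) lerXn2r ?nnegrE ?(ltW B0).
    have : 1 <= B ^+ 2 by rewrite exprn_ege1.
    by rewrite ler_norml => *; apply/andP; split; lra.
  have h : `|u * e ^+ 2 / 2 * (x ^+ 2 - 1)| <= L * e ^+ 2 / 2 * B ^+ 2.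
    rewrite normrM ler_pM// -mulrA normrM (gtr0_norm (_ : 0 < e ^+ 2 / 2)) ?divr_gt0//.
    by rewrite -mulrA ler_pM2r ?divr_gt0.
  rewrite normrM (le_trans (ler_pM _ _ rho1 h))//.
  by rewrite le_eqVlt; apply/orP; left; apply/eqP; field.
have := ler_normD (rho * t1 + e * x * t2 - e ^+ 3 * (Q * x)) ((rho - 1) * (u * e ^+ 2 / 2 * (x ^+ 2 - 1))).
have := ler_normB (rho * t1 + e * x * t2) (e ^+ 3 * (Q * x)).
have := ler_normD (rho * t1) (e * x * t2).
have : 0 < B ^+ 3 * (L ^+ 2 * e ^+ 3) by rewrite mulr_gt0.
lra.
Qed.

Lemma Phi_diff_mono (u : R) : {mono Phi_diff u : x y / x <= y}.
Proof.
move=> x y; rewrite /Phi_diff ler_pM2r ?invr_gt0 ?gauss_pdf_gt0//.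
by rewrite lerD2l lerN2 Phi_mono lerD2l lerN2.
Qed.

(** A coarser form, for arguments of order [L e ^ 2]: there the error [L x ^ 2] is already below
    [L ^ 2 e ^ 3]. *)
Lemma Phi_diff_approx (L u x : R) : 1 <= L -> `|u| <= L -> L * `|x| <= 1 / 4 ->
  `|Phi_diff u x - x| <= 2 * L * x ^+ 2.
Proof.
move=> L1 uL Lx; have t := Phi_diff_taylor L1 uL Lx.
have -> : Phi_diff u x - x = (Phi_diff u x - x - u * x ^+ 2 / 2) + u * x ^+ 2 / 2 by ring.
rewrite (le_trans (ler_normD _ _))//.
have h : `|u * x ^+ 2 / 2| <= L * x ^+ 2 / 2.
  have x2 : 0 <= x ^+ 2 / 2 by rewrite divr_ge0 ?sqr_ge0.
  have -> : u * x ^+ 2 / 2 = u * (x ^+ 2 / 2) by rewrite mulrA.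
  by rewrite normrM (ger0_norm x2) -[leRHS]mulrA ler_wpM2r.
have h2 : 5 * L ^+ 2 * `|x| ^+ 3 <= 5 / 4 * (L * x ^+ 2).
  rewrite -(real_normK (num_real x)).
  have -> : 5 * L ^+ 2 * `|x| ^+ 3 = 5 * (L * `|x| ^+ 2) * (L * `|x|) by ring.
  have : 0 <= L * `|x| ^+ 2 by rewrite mulr_ge0 ?sqr_ge0// (le_trans _ L1).
  by move: (L * `|x|) (L * `|x| ^+ 2) Lx => p q; nra.
have : 0 <= L * x ^+ 2 by rewrite mulr_ge0 ?sqr_ge0// (le_trans _ L1).
lra.
Qed.

(* The point u / sqrt (1 + e^2) matches [Phi] at variance 1 + e^2 up to O(e^3). *)
Lemma gauss_quantile_close (K L e u t : R) :
  0 < K -> 1 <= L -> 0 < e -> (K + 10) * (L * e) <= 1 -> `|u| <= L ->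
  `|Phi_diff u (u - t) - u * e ^+ 2 / 2| <= K * (L ^+ 2 * e ^+ 3) ->
  `|Num.sqrt (1 + e ^+ 2) * t - u| <= 2 * (K + 10) * (L ^+ 2 * e ^+ 3).
Proof.
move=> K0 L1 e0 small uL h.
set r := Num.sqrt (1 + e ^+ 2).
have L0 : 0 < L by exact: lt_le_trans L1.
have e2 : 0 < e ^+ 2 by rewrite exprn_gt0.
have Le0 : 0 < L * e by rewrite mulr_gt0.
have eLe : e <= L * e by rewrite ler_peMl // ltW.
have Le1 : L * e <= 1 / 10 by nra.
have e1 : e <= 1 / 10 by exact: le_trans Le1.
have rr : r ^+ 2 = 1 + e ^+ 2 by rewrite sqr_sqrtr// addr_ge0// ltW.
have r0 : 0 <= r by rewrite sqrtr_ge0.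
have r1 : 1 <= r by rewrite -(@ler_sqr _ 1) ?nnegrE// rr expr1n lerDl ltW.
have r2 : r <= 2 by nra.
have ri0 : 0 < r by exact: lt_le_trans r1.
(* The displacement [u - t] for the ideal value [t = u / r] is [u * k], and [k] is [e ^ 2 / 2] up to
   [e ^ 4]. *)
pose k := 1 - r^-1.
have rk : r * (1 - k) = 1 by rewrite /k subKr divff// gt_eqF.
have k0 : 0 <= k by rewrite subr_ge0 invf_le1.
have ku : k <= e ^+ 2 / 2 by nra.
have kl : e ^+ 2 / 2 - e ^+ 4 <= k.
  (* With [y = e ^ 2], compare the squares of [1 - k] and [1 - (y / 2 - y ^ 2)] after multiplication
     by [1 + y]: the former gives exactly 1, the latter at least 1. *)
  have rk2 : (1 + e ^+ 2) * (1 - k) ^+ 2 = 1 by rewrite -rr -exprMn rk expr1n.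
  have -> : e ^+ 4 = (e ^+ 2) ^+ 2 by rewrite -exprM.
  move: (e ^+ 2) e2 ku rk2 => y y0 ku rk2.
  have k1 : k <= 1 by rewrite lerBlDr lerDl invr_ge0.
  have q1 : 0 <= 1 - (y / 2 - y ^+ 2) by nra.
  suff : 1 - k <= 1 - (y / 2 - y ^+ 2) by lra.
  rewrite -ler_sqr ?nnegrE ?(subr_ge0 k)//.
  rewrite -(@ler_pM2l _ (1 + y)) ?rk2 ?addr_gt0//.
  have -> : (1 + y) * (1 - (y / 2 - y ^+ 2)) ^+ 2 =
    1 + y ^+ 2 + 2 * y ^+ 3 + (1 + y) * (y / 2 - y ^+ 2) ^+ 2 by field.
  have y3 : 0 <= y ^+ 3 by rewrite exprn_ge0// ltW.
  have y2 : 0 <= (1 + y) * (y / 2 - y ^+ 2) ^+ 2.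
    by rewrite mulr_ge0 ?sqr_ge0// addr_ge0// ltW.
  have := sqr_ge0 y; lra.
set M := L ^+ 2 * e ^+ 3 in h *.
have M0 : 0 < M by rewrite mulr_gt0 // exprn_gt0.
have Me : M = (L * e) * (L * e ^+ 2) by rewrite /M; ring.
(* [Phi_diff u] is increasing, so it suffices to evaluate it at [u * k + hh] and [u * k - hh]. The
   margin covers [K * M] from the hypothesis, [M] from [uk] and [8 * M] from [key]. *)
pose hh := (K + 10) * M.
have hhe : hh <= L * e ^+ 2.
  rewrite /hh Me mulrA ler_piMl// mulr_ge0 ?ltW//.
have uk : `|u * k - u * e ^+ 2 / 2| <= M.
  have -> : u * k - u * e ^+ 2 / 2 = u * (k - e ^+ 2 / 2) by ring.
  have kb : `|k - e ^+ 2 / 2| <= e ^+ 4.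
    have e4 : 0 <= e ^+ 4 by rewrite exprn_ge0// ltW.
    by rewrite ler_norml; apply/andP; split; lra.
  rewrite normrM (le_trans (ler_pM _ _ uL kb))//.
  have -> : M = L * (e ^+ 3 * L) by rewrite /M; ring.
  rewrite ler_pM2l// [leLHS]exprSr ler_pM2l ?exprn_gt0//. lra.
have key (x : R) : `|x - u * k| = hh -> `|Phi_diff u x - x| <= 8 * M.
  move=> xh.
  have x2 : `|x| <= 2 * (L * e ^+ 2).
    have -> : x = (x - u * k) + u * k by ring.
    rewrite (le_trans (ler_normD _ _))// xh normrM (ger0_norm k0).
    have : `|u| * k <= L * e ^+ 2.
      by rewrite ler_pM// (le_trans ku)//; lra.
    lra.
  have Lx : L * `|x| <= 1 / 4.
    rewrite (@le_trans _ _ (L * (2 * (L * e ^+ 2)))) ?ler_pM2l//.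
    have -> : L * (2 * (L * e ^+ 2)) = 2 * (L * e) ^+ 2 by ring.
    nra.
  rewrite (le_trans (Phi_diff_approx L1 uL Lx))//.
  rewrite -(real_normK (num_real x)).
  have : `|x| ^+ 2 <= (2 * (L * e ^+ 2)) ^+ 2.
    by rewrite lerXn2r ?nnegrE// (le_trans _ x2).
  move=> /(ler_wpM2l (ltW L0)) h1.
  have : L * (2 * (L * e ^+ 2)) ^+ 2 <= 4 * M.
    have -> : L * (2 * (L * e ^+ 2)) ^+ 2 = 4 * M * (L * e) by rewrite Me; ring.
    nra.
  lra.
have hh0 : 0 < hh by rewrite mulr_gt0// addr_gt0.
have up : u - t <= u * k + hh.
  rewrite -(Phi_diff_mono u).
  have := key (u * k + hh); rewrite addrAC subrr add0r gtr0_norm// => /(_ erefl).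
  move: h uk; rewrite /hh !ler_norml => /andP[_ ?] /andP[? _] /andP[? _].
  lra.
have lo : u * k - hh <= u - t.
  rewrite -(Phi_diff_mono u).
  have := key (u * k - hh); rewrite addrAC subrr add0r normrN gtr0_norm// => /(_ erefl).
  move: h uk; rewrite /hh !ler_norml => /andP[? _] /andP[_ ?] /andP[_ ?].
  lra.
have -> : r * t - u = - (r * (u - t - u * k)).
  have -> : u - t - u * k = u * (1 - k) - t by ring.
  by rewrite mulrBr mulrCA rk mulr1 opprB.
rewrite normrN normrM (ger0_norm r0) -mulrA ler_pM//.
by rewrite ler_norml; apply/andP; split; rewrite -/hh; lra.
Qed.

End transport_error.

(** * Averaging the third-order expansion *)

Section tilted_transport.
Context d (T : measurableType d) (R : realType) (P : probability T R).

Lemma bounded_Rintegral_le (f : T -> R) (M : R) : measurable_fun setT f ->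
  (forall w, `|f w| <= M) -> `|\int[P]_w f w| <= M.
Proof.
move=> mf fM; have fi := bounded_integrable P mf fM.
rewrite (le_trans (le_normr_Rintegral measurableT fi))//.
rewrite -[leRHS](Rintegral_probability_cst P); apply: le_Rintegral => //.
- exact: integrable_norm.
- exact: finite_measure_integrable_cst.
Qed.

(** Apply [tilted_taylor] for each [w] with [e = 1 / s] and [u = y / s], then integrate. The
    polynomial [G] has mean zero by the moment hypotheses. Dividing by the total weight, which is at
    least 1/2, turns 23 into 46, and [gauss_quantile_close] converts the estimate on [Phi_diff] into
    one on [t]. *)
Lemma tilted_transport_close (X S Q : T -> R) (B L s y t : R) :
  measurable_fun setT X -> measurable_fun setT S -> measurable_fun setT Q ->
  1 <= B -> 1 <= L -> 0 < s -> (46 * B ^+ 3 + 10) * L <= s ->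
  (forall w, `|X w| <= B) -> (forall w, `|S w| <= L * B) ->
  (forall w, 0 <= Q w <= B) ->
  \int[P]_w X w = 0 -> \int[P]_w (X w ^+ 2) = 1 -> \int[P]_w (S w * X w) = 0 ->
  let rho w := expR (S w / s - Q w / s ^+ 2) in
  `|y| <= s * L ->
  (\int[P]_w rho w) * Phi t = \int[P]_w (rho w * Phi ((y - X w) / s)) ->
  `|Num.sqrt (s ^+ 2 + 1) * t - y| <= 2 * (46 * B ^+ 3 + 10) * (L ^+ 2 / s ^+ 2).
Proof.
move=> mX mS mQ B1 L1 s0 small XB SB QB X0 X1 SX rho yL Wt.
have B0 : 0 < B by exact: lt_le_trans B1.
have L0 : 0 < L by exact: lt_le_trans L1.
have B3 : 1 <= B ^+ 3 by rewrite exprn_ege1.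
have BB3 : B <= B ^+ 3 by rewrite exprS ler_peMr ?exprn_ege1// ltW.
pose e := s^-1; pose u := y / s.
have e0 : 0 < e by rewrite invr_gt0.
have se : s * e = 1 by rewrite divff// gt_eqF.
have small' : (46 * B ^+ 3 + 10) * (L * e) <= 1.
  by rewrite mulrA -[leRHS]se ler_pM2r.
have Le0 : 0 < L * e by rewrite mulr_gt0.
have uL : `|u| <= L by rewrite normrM (gtr0_norm e0) ler_pdivrMr// mulrC.
have yE : y = s * u by rewrite /u mulrCA divff ?mulr1// gt_eqF.
have small8 : 8 * B * (L * e) <= 1.
  by rewrite (le_trans _ small')// ler_pM2r//; lra.
have tay w := tilted_taylor B1 L1 e0 small8 uL (XB w) (SB w) (QB w).
have rhoE w : rho w = expR (e * S w - e ^+ 2 * Q w).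
  by rewrite /rho /e; congr expR; field; rewrite gt_eqF.
pose M := L ^+ 2 * e ^+ 3.
have M0 : 0 < M by rewrite mulr_gt0 ?exprn_gt0.
pose F w := rho w * (Phi_diff u (e * X w) - u * e ^+ 2 / 2).
pose G w := e * X w + e ^+ 2 * (S w * X w) + u * e ^+ 2 / 2 * (X w ^+ 2 - 1).
have FG w : `|F w - G w| <= 23 * B ^+ 3 * M.
  by have [_ _] := tay w; rewrite -rhoE.
have rhob w : 1 / 2 <= rho w <= 3 / 2 by have [] := tay w; rewrite -rhoE => -> ->.
have mrho : measurable_fun setT rho.
  apply: measurableT_comp => //; apply: measurable_funB; exact: measurable_funM.
have irho : P.-integrable setT (EFin \o rho).
  apply: (@bounded_integrable _ _ _ _ _ (3 / 2)) => // w.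
  by have /andP[r1 r2] := rhob w; rewrite ger0_norm//; lra.
have mPhi : measurable_fun setT (fun w => Phi ((y - X w) / s)).
  apply: (measurableT_comp measurable_Phi).
  by apply: measurable_funM => //; exact: measurable_funB.
have irhoPhi : P.-integrable setT (EFin \o (fun w => rho w * Phi ((y - X w) / s))).
  apply: (@bounded_integrable _ _ _ _ _ (3 / 2)); first exact: measurable_funM.
  move=> w; have /andP[r1 r2] := rhob w; rewrite normrM -[leRHS]mulr1 ler_pM//.
    by rewrite ger0_norm//; lra.
  by rewrite ger0_norm ?Phi_ge0// Phi_le1.
set W := \int[P]_w rho w in Wt.
have W12 : 1 / 2 <= W.
  rewrite -(Rintegral_probability_cst P (1 / 2)); apply: le_Rintegral => //.
    exact: finite_measure_integrable_cst.
  by move=> w _; have /andP[] := rhob w.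
(* [Phi_diff u x] is affine in [Phi (u - x)], so averaging with weights [rho] turns the equation
   [Wt] for [t] into one for [Phi_diff u (u - t)]. *)
have FE : \int[P]_w F w = W * (Phi_diff u (u - t) - u * e ^+ 2 / 2).
  pose c := Phi u / gauss_pdf u - u * e ^+ 2 / 2.
  transitivity (\int[P]_w (rho w * c - rho w * Phi ((y - X w) / s) * (gauss_pdf u)^-1)).
    apply: eq_Rintegral => w _; rewrite /F /Phi_diff /c.
    have -> : (y - X w) / s = u - e * X w by rewrite mulrBl [X in _ - X]mulrC.
    by ring.
  rewrite RintegralB//; last 2 first.
  - by have := integrableZr measurableT c irho.
  - by have := integrableZr measurableT (gauss_pdf u)^-1 irhoPhi.
  rewrite !RintegralZr// -Wt -/W /c /Phi_diff subKr.
  by ring.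
have mF : measurable_fun setT F.
  apply: measurable_funM => //; apply: measurable_funB => //.
  apply: measurable_funM => //; apply: measurable_funB => //.
  apply: (measurableT_comp measurable_Phi); apply: measurable_funB => //.
  exact: measurable_funM.
have mG : measurable_fun setT G.
  apply: measurable_funD; first apply: measurable_funD.
  - exact: measurable_funM.
  - by apply: measurable_funM => //; exact: measurable_funM.
  - apply: measurable_funM => //; apply: measurable_funB => //.
    exact: measurable_funX.
have iX : P.-integrable setT (EFin \o X) by exact: (bounded_integrable P mX XB).
have iX2 : P.-integrable setT (EFin \o (fun w => X w ^+ 2)).
  apply: (@bounded_integrable _ _ _ _ _ (B ^+ 2)); first exact: measurable_funX.
  by move=> w; rewrite normrX lerXn2r ?nnegrE ?(ltW B0).
have iSX : P.-integrable setT (EFin \o (fun w => S w * X w)).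
  apply: (@bounded_integrable _ _ _ _ _ (L * B * B)); first exact: measurable_funM.
  by move=> w; rewrite normrM ler_pM.
have ic (c : R) : P.-integrable setT (EFin \o cst c).
  exact: finite_measure_integrable_cst.
have G0 : \int[P]_w G w = 0.
  have i1 := integrableZl measurableT e iX.
  have i2 := integrableZl measurableT (e ^+ 2) iSX.
  have i3 := integrableB measurableT iX2 (ic 1).
  have i4 := integrableZl measurableT (u * e ^+ 2 / 2) i3.
  rewrite RintegralD//; last by have := integrableD measurableT i1 i2.
  rewrite RintegralD// !RintegralZl// X0 SX.
  rewrite RintegralB//; last exact: (ic 1).
  rewrite X1 Rintegral_probability_cst.
  by rewrite subrr !mulr0 !addr0.
have iG : P.-integrable setT (EFin \o G).
  have h w : `|G w| <= e * B + e ^+ 2 * (L * B * B) + `|u * e ^+ 2 / 2| * (B ^+ 2 + 1).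
    rewrite (le_trans (ler_normD _ _))// lerD//.
      rewrite (le_trans (ler_normD _ _))// lerD//.
        by rewrite normrM (gtr0_norm e0) ler_pM2l.
      by rewrite normrM (gtr0_norm (exprn_gt0 2 e0)) ler_pM2l ?exprn_gt0// normrM ler_pM.
    rewrite normrM ler_wpM2l// (le_trans (ler_normB _ _))// normr1 lerD2r.
    by rewrite normrX lerXn2r ?nnegrE ?(ltW B0).
  exact: (bounded_integrable P mG h).
have iFG : P.-integrable setT (EFin \o (fun w => F w - G w)).
  by apply: (bounded_integrable P _ FG); exact: measurable_funB.
have WF : `|W * (Phi_diff u (u - t) - u * e ^+ 2 / 2)| <= 23 * B ^+ 3 * M.
  rewrite -FE -[X in `|X|]subr0 -G0 -RintegralB//; last first.
    apply: eq_integrable (integrableD measurableT iFG iG) => // w _ /=.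
    by rewrite -EFinD subrK.
  by apply: bounded_Rintegral_le => //; exact: measurable_funB.
have close : `|Phi_diff u (u - t) - u * e ^+ 2 / 2| <= 46 * B ^+ 3 * M.
  move: WF; rewrite normrM (ger0_norm (_ : 0 <= W)); last by lra.
  have : 0 <= `|Phi_diff u (u - t) - u * e ^+ 2 / 2| by [].
  nra.
have K0 : 0 < 46 * B ^+ 3 by lra.
have h := gauss_quantile_close K0 L1 e0 small' uL close.
have -> : Num.sqrt (s ^+ 2 + 1) = s * Num.sqrt (1 + e ^+ 2).
  rewrite -{2}(gtr0_norm s0) -sqrtr_sqr -sqrtrM ?sqr_ge0//.
  by rewrite mulrDr mulr1 -exprMn se expr1n.
rewrite -(ler_pM2l s0) in h.
rewrite yE -[s * _ * t]mulrA -mulrBr normrM (gtr0_norm s0) (le_trans h)//.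
rewrite le_eqVlt; apply/orP; left; apply/eqP.
by rewrite /e; field; rewrite gt_eqF.
Qed.

End tilted_transport.

(** * The Knothe map *)

Section knothe.
Context {R : realType}.

Definition isotropic d (T : measurableType d) (P : probability T R) n
    (X : T -> 'rV[R]_n) : Prop :=
  (forall i, \int[P]_w X w ord0 i = 0) /\
  (forall i j, \int[P]_w (X w ord0 i * X w ord0 j) = (i == j)%:R).

(** Test functions are used in place of image measures, so that the identity can be applied inside
    iterated integrals. *)
Definition gauss_transport d (T : measurableType d) (P : probability T R) n
    (X : T -> 'rV[R]_n) (s : R) (F : 'rV[R]_n -> 'rV[R]_n) : Prop :=
  forall f : 'rV[R]_n -> \bar R,
    measurable_fun setT f -> (forall x, 0 <= f x)%E ->
  (\int[P]_w \int[std_normal R n]_z f (F (X w + s *: z)%R) =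
   \int[std_normal R n]_z f z)%E.

Variables (N : nat) (beta : R).
Hypothesis beta1 : 1 <= beta.

(** One bound for the first coordinate, for [S / L] and for [Q] in every dimension up to [N]. It
    stays fixed along the induction on the dimension, so the constants do not grow. *)
Let B : R := N.+1%:R * beta ^+ 2.

Definition knothe_const : R := 46 * B ^+ 3 + 10.

(** Puts the tilt in the form [expR (S / s - Q / s ^+ 2)] that [tilted_transport_close] expects. *)
Lemma tilt_scale n (a v : 'rV[R]_n) (s : R) : s != 0 ->
  tilt (s^-1 *: a) (s^-1 *: v) =
  expR ((\sum_i a ord0 i * (v ord0 i / s)) / s - (\sum_i a ord0 i ^+ 2 / 2) / s ^+ 2).
Proof.
move=> s0; rewrite /tilt !mulr_suml -sumrB; congr expR; apply: eq_bigr => i _.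
by rewrite !mxE; field.
Qed.

(** The tail is moved by the map of the induction hypothesis, and the first coordinate by a monotone
    map that depends on the tail. Conditioning on the tail is realized by the density [rho] in place
    of a disintegration: tilting makes the tail a fixed point [s *: z], independent of [w], while
    the first coordinate is treated. *)
Lemma knothe_transport n d (T : measurableType d) (P : probability T R)
    (X : T -> 'rV[R]_n) (s : R) : (n <= N)%N ->
  measurable_fun setT X -> (forall w i, `|X w ord0 i| <= beta) ->
  isotropic P X -> 0 < s ->
  exists F : 'rV[R]_n -> 'rV[R]_n, [/\ measurable_fun setT F,
    gauss_transport P X s F &
    forall (L : R) (y : 'rV[R]_n), 1 <= L -> knothe_const * L <= s ->
      (forall i, `|y ord0 i| <= s * L) ->
      forall i, `|Num.sqrt (s ^+ 2 + 1) * F y ord0 i - y ord0 i| <=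
        2 * knothe_const * (L ^+ 2 / s ^+ 2)].
Proof.
elim: n X => [|n IH] X nN mX Xb [X0 X1] s0.
  exists id; split => // [f mf f0|L y _ _ _ []//].
  under eq_integral do under eq_integral => z _ do rewrite (rV0_eq (_ + _)%R z).
  by rewrite integral_cst//= probability_setT mule1.
pose X' w := rV_tail (X w); pose X0' w := X w ord0 ord0.
have mX' : measurable_fun setT X' by exact: measurable_fun_rV_tail.
have mX0 : measurable_fun setT X0' by exact: measurable_fun_coord.
have X'E w j : X' w ord0 j = X w ord0 (lift ord0 j) by rewrite mxE.
have [F [mF Ftr Fclose]] : exists F : 'rV[R]_n -> 'rV[R]_n, [/\ measurable_fun setT F,
    gauss_transport P X' s F &
    forall (L : R) (y : 'rV[R]_n), 1 <= L -> knothe_const * L <= s ->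
      (forall i, `|y ord0 i| <= s * L) ->
      forall i, `|Num.sqrt (s ^+ 2 + 1) * F y ord0 i - y ord0 i| <=
        2 * knothe_const * (L ^+ 2 / s ^+ 2)].
  apply: IH => //; first exact: ltnW.
    by move=> w i; rewrite X'E.
  split=> [i|i j].
    by under eq_Rintegral do rewrite X'E.
  under eq_Rintegral do rewrite !X'E.
  by rewrite X1 (inj_eq lift_inj).
have sn0 : s != 0 by rewrite gt_eqF.
pose rho v w := tilt (s^-1 *: X' w) (s^-1 *: v).
have mrho : measurable_fun setT (fun p : 'rV[R]_n * T => rho p.1 p.2).
  apply: measurable_fun_tilt; apply: measurable_fun_rVZ => //.
  exact: measurableT_comp.
have rhob v : exists2 K : R, 0 < K & forall w, K^-1 <= rho v w <= K.
  have [M bM] : exists M : R, forall w, `|\sum_i ((s^-1 *: X' w) ord0 i * (s^-1 *: v) ord0 i -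
      (s^-1 *: X' w) ord0 i ^+ 2 / 2)| <= M.
    exists (\sum_i (beta / s * `|(s^-1 *: v) ord0 i| + (beta / s) ^+ 2 / 2)) => w.
    rewrite (le_trans (ler_norm_sum _ _ _))// ler_sum// => i _.
    have aib : `|(s^-1 *: X' w) ord0 i| <= beta / s.
      by rewrite mxE X'E normrM gtr0_norm ?invr_gt0// mulrC ler_pM2r ?invr_gt0.
    rewrite (le_trans (ler_normB _ _))// lerD//.
      by rewrite normrM ler_wpM2r.
    have h0 : 0 <= (s^-1 *: X' w) ord0 i ^+ 2 / 2 by rewrite divr_ge0 ?sqr_ge0.
    rewrite (ger0_norm h0) ler_pM2r// -(real_normK (num_real _)).
    by rewrite lerXn2r ?nnegrE// divr_ge0 ?(ltW s0)// (le_trans _ beta1).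
  exists (expR M) => [|w]; first exact: expR_gt0.
  by move: (bM w); rewrite -expRN !ler_expR ler_norml.
pose F0 := weighted_transport P X0' s rho.
have mF0 : measurable_fun setT F0.
  exact: (measurable_weighted_transport P mX0 (fun w => Xb w ord0) s0 mrho rhob).
pose G (y : 'rV[R]_n.+1) := rV_cons (F0 (y ord0 ord0, rV_tail y)) (F (rV_tail y)).
have mG : measurable_fun setT G.
  apply: measurable_fun_rV_cons.
    apply: (measurableT_comp mF0); apply: measurable_fun_pair.
      exact: measurable_coord.
    exact: measurable_fun_rV_tail.
  by apply: (measurableT_comp mF); exact: measurable_fun_rV_tail.
exists G; split => //.
- move=> f mf f0.
  pose a w := s^-1 *: X' w.
  have sa w : s *: a w = X' w by rewrite scalerA divff// scale1r.
  have aE w z : tilt (a w) z = rho (s *: z) w.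
    by rewrite /rho scalerA mulVf// scale1r.
  have ma : measurable_fun setT a by exact: measurable_fun_rVZ.
  pose h (x : R) (v : 'rV[R]_n) := f (rV_cons x v).
  have h0 x v : (0 <= h x v)%E by exact: f0.
  have mh d1 (T1 : measurableType d1) (p : T1 -> R) (q : T1 -> 'rV[R]_n) :
      measurable_fun setT p -> measurable_fun setT q ->
      measurable_fun setT (fun t => h (p t) (q t)).
    by move=> mp mq; apply: (measurableT_comp mf); exact: measurable_fun_rV_cons.
  have mF0' d1 (T1 : measurableType d1) (p : T1 -> R) (q : T1 -> 'rV[R]_n) :
      measurable_fun setT p -> measurable_fun setT q ->
      measurable_fun setT (fun t => F0 (p t, q t)).
    by move=> mp mq; apply: (measurableT_comp mF0); exact: measurable_fun_pair.
  pose g w v := (\int[gauss]_x h (F0 ((X0' w + s * x)%R, v)) (F v))%E.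
  have g0 w v : (0 <= g w v)%E by exact: integral_ge0.
  have mg d1 (T1 : measurableType d1) (p : T1 -> T) (q : T1 -> 'rV[R]_n) :
      measurable_fun setT p -> measurable_fun setT q ->
      measurable_fun setT (fun t => g (p t) (q t)).
    move=> mp mq; apply: measurable_fun_integral => //.
    apply: mh; last first.
      by apply: (measurableT_comp mF); exact: measurableT_comp.
    apply: mF0'; last exact: measurableT_comp.
    apply: measurable_funD; last exact: measurable_funM.
    by apply: (measurableT_comp mX0); exact: measurableT_comp.
  have mt d1 (T1 : measurableType d1) (p : T1 -> T) (q : T1 -> 'rV[R]_n) :
      measurable_fun setT p -> measurable_fun setT q ->
      measurable_fun setT (fun t => (tilt (a (p t)) (q t))%:E).
    move=> mp mq; apply/measurable_EFinP; apply: measurable_fun_tilt => //.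
    exact: measurableT_comp.
  have t0 w z : (0 <= (tilt (a w) z)%:E)%E by rewrite lee_fin ltW ?tilt_gt0.
  pose hh v := (\int[gauss]_x h x v)%E.
  have hh0 v : (0 <= hh v)%E by exact: integral_ge0.
  have mhh : measurable_fun setT hh.
    by apply: measurable_fun_integral => //; exact: mh.
  have msz d1 (T1 : measurableType d1) (q : T1 -> 'rV[R]_n) :
    measurable_fun setT q -> measurable_fun setT (fun t => s *: q t) by exact: measurable_fun_rVZ.
  (* Cameron-Martin trades the shift [X' w] of the tail for the density [tilt (a w)]. The tail is
     then [s *: z] for all [w], and the integrals can be exchanged. *)
  transitivity (\int[P]_w \int[std_normal R n]_z (g w (s *: z) * (tilt (a w) z)%:E))%E.
    apply: eq_integral => w _.
    rewrite ge0_integral_std_normalS//; last first.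
      apply: (measurableT_comp mf); apply: (measurableT_comp mG).
      apply: measurable_fun_rVD => //. apply: measurable_fun_rVZ; exact: measurable_id.
    transitivity (\int[gauss]_x \int[std_normal R n]_z
        h (F0 ((X0' w + s * x)%R, (X' w + s *: z)%R)) (F (X' w + s *: z)%R))%E.
      apply: eq_integral => x _; apply: eq_integral => z _.
      rewrite /h /G (rV_consE (X w)) rV_consZ rV_consD rV_cons0 rV_consK.
      by [].
    rewrite ge0_integral_swap//; last first.
      apply: mh; last first.
        by apply: (measurableT_comp mF); apply: measurable_fun_rVD => //; exact: msz.
      apply: mF0'; last by apply: measurable_fun_rVD => //; exact: msz.
      by apply: measurable_funD => //; exact: measurable_funM.
    have mgs : measurable_fun setT (fun z : 'rV[R]_n => g w (s *: z)).
      by apply: (mg _ _ (cst w)) => //; exact: msz.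
    apply: etrans (ge0_integral_std_normal_shift (a w) mgs _); last by move=> z; exact: g0.
    by apply: eq_integral => z _; rewrite scalerDr sa addrC.
  rewrite ge0_integral_swap//; last 2 first.
  - by apply: emeasurable_funM; [apply: mg => //; exact: msz|exact: mt].
  - by move=> w z; rewrite mule_ge0.
  (* With [z] fixed, [F0] sends the mixture weighted by [rho (s *: z)] to its total weight times
     N(0, 1); the first coordinate is thereby integrated out. *)
  transitivity (\int[std_normal R n]_z \int[P]_w (hh (F (s *: z)) * (tilt (a w) z)%:E))%E.
    apply: eq_integral => z _.
    rewrite ge0_integralZl//; last first.
      by apply: (mt _ _ id (cst z)).
    have := @ge0_integral_weighted_transport _ _ _ _ _ P X0' beta s rho mX0
       (fun w => Xb w ord0) s0 mrho rhob (s *: z) (fun x => h x (F (s *: z))).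
    rewrite -/F0 => H.
    transitivity ((weight P rho (s *: z))%:E * hh (F (s *: z)))%E; last first.
      rewrite muleC; congr (_ * _)%E; rewrite /weight.
      under [RHS]eq_integral do rewrite aE.
      rewrite EFin_Rintegral//; have [K K0 rK] := rhob (s *: z).
      apply: (@bounded_integrable _ _ _ _ _ K).
        exact: (measurableT_comp mrho (measurable_pair1 _)).
      by move=> w; have /andP[_] := rK w; rewrite ger0_norm// ltW// tilt_gt0.
    have mhF : measurable_fun setT (fun x => h x (F (s *: z))) by apply: mh.
    apply: etrans (H mhF (fun x => h0 x _)).
    apply: eq_integral => w _; rewrite aE muleC; congr (_ * _)%E.
  rewrite -ge0_integral_swap//; last 2 first.
  - apply: emeasurable_funM; last exact: mt.
    by apply: (measurableT_comp mhh); apply: (measurableT_comp mF); exact: msz.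
  - by move=> w z; rewrite mule_ge0.
  (* Cameron-Martin backwards restores the shift of the tail, so that the induction hypothesis
     applies to [hh]. *)
  transitivity (\int[P]_w \int[std_normal R n]_z hh (F (X' w + s *: z)%R))%E.
    apply: eq_integral => w _.
    have mhs : measurable_fun setT (fun z : 'rV[R]_n => hh (F (s *: z))).
      by apply: (measurableT_comp mhh); apply: (measurableT_comp mF); exact: msz.
    apply: etrans (esym (ge0_integral_std_normal_shift (a w) mhs _)) _.
      by move=> z; exact: hh0.
    by apply: eq_integral => z _; rewrite scalerDr sa addrC.
  rewrite Ftr// /hh ge0_integral_swap//; last by apply: mh.
  by rewrite ge0_integral_std_normalS.
move=> L y L1 small yL i; case: (unliftP ord0 i) => [j|] ->.
  have yj : rV_tail y ord0 j = y ord0 (lift ord0 j) by rewrite mxE.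
  rewrite rV_consS -yj.
  by apply: Fclose => // k; rewrite mxE.
rewrite rV_cons0.
have b0 : 0 <= beta by exact: le_trans beta1.
have bb : beta <= beta ^+ 2 by rewrite expr2 ler_peMl.
have nB (c : R) : 0 <= c -> c <= beta ^+ 2 -> \sum_(j < n) c <= B.
  move=> c0 cb; rewrite sumr_const card_ord -[leLHS]mulr_natl /B ler_pM//.
  by rewrite ler_nat (leq_trans (leqnSn n)) // (leq_trans nN).
have bB : beta <= B.
  by rewrite /B (le_trans bb)// ler_peMl ?sqr_ge0// ler1n.
pose v := rV_tail y.
have vL j : `|v ord0 j / s| <= L.
  by rewrite normrM (gtr0_norm (_ : 0 < s^-1)) ?invr_gt0// ler_pdivrMr// mxE mulrC.
pose S w := \sum_j X' w ord0 j * (v ord0 j / s).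
pose Q w := \sum_j X' w ord0 j ^+ 2 / 2.
have iXX (k j : 'I_n.+1) : P.-integrable setT (EFin \o (fun w => X w ord0 k * X w ord0 j)).
  apply: (@bounded_integrable _ _ _ _ _ (beta * beta)).
    by apply: measurable_funM; exact: measurable_fun_coord.
  by move=> w; rewrite normrM ler_pM.
have mX'j j : measurable_fun setT (fun w => X' w ord0 j) by exact: measurable_fun_coord.
apply: (@tilted_transport_close _ _ _ P X0' S Q B L s) => //.
- by apply: measurable_sum => j; exact: measurable_funM.
- by apply: measurable_sum => j; apply: measurable_funM => //; exact: measurable_funX.
- exact: le_trans bB.
- by move=> w; exact: le_trans (Xb _ _) bB.
- move=> w; rewrite (le_trans (ler_norm_sum _ _ _))//.
  rewrite (@le_trans _ _ (\sum_(j < n) L * beta))//.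
    by apply: ler_sum => j _; rewrite normrM mulrC ler_pM// X'E.
  by rewrite -mulr_sumr ler_wpM2l ?(le_trans _ L1)// nB.
- move=> w; rewrite sumr_ge0 => [|j _]; last by rewrite divr_ge0 ?sqr_ge0.
  rewrite (@le_trans _ _ (\sum_(j < n) beta ^+ 2))//; last by rewrite nB ?sqr_ge0.
  apply: ler_sum => j _; rewrite X'E.
  have : X w ord0 (lift ord0 j) ^+ 2 <= beta ^+ 2.
    by rewrite -(real_normK (num_real _)) lerXn2r ?nnegrE.
  have := sqr_ge0 (X w ord0 (lift ord0 j)); lra.
- exact: X0.
- by under eq_Rintegral do rewrite expr2; rewrite X1 eqxx.
(* [S] is a linear combination of the other coordinates, each uncorrelated with the first. *)
- transitivity (\sum_j \int[P]_w ((v ord0 j / s) * (X w ord0 (lift ord0 j) * X w ord0 ord0))).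
    rewrite -Rintegral_sum => [|j].
      apply: eq_Rintegral => w _; rewrite /S mulr_suml; apply: eq_bigr => j _.
      by rewrite X'E mulrAC mulrC.
    by have := integrableZl measurableT (v ord0 j / s) (iXX (lift ord0 j) ord0).
  rewrite big1// => j _.
  by rewrite RintegralZl// X1 eq_sym (negbTE (neq_lift _ _)) ?mulr0.
- have := @Phi_weighted_transport _ _ _ _ _ P X0' beta s rho mX0
    (fun w => Xb w ord0) s0 mrho rhob (y ord0 ord0) v.
  rewrite /weight /weighted_cdf.
  have -> : rho v = fun w => expR (S w / s - Q w / s ^+ 2).
    by apply/funext => w; rewrite /rho tilt_scale.
  exact.
Qed.

End knothe.

(** * Mean square cost of one replacement *)

Section transport_cost.
Context {R : realType}.

Lemma sqr_le_expR (x : R) : x ^+ 2 <= 2 * expR `|x|.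
Proof.
rewrite -(real_normK (num_real x)).
have := expR_ge1Dxn 1 (normr_ge0 x); rewrite (_ : 2`!%:R = 2 :> R)//; lra.
Qed.

Lemma expr4_le_expR (x : R) : x ^+ 4 <= 24 * expR `|x|.
Proof.
have -> : x ^+ 4 = `|x| ^+ 4 by rewrite (exprM x 2 2) -(real_normK (num_real x)) -exprM.
have := expR_ge1Dxn 3 (normr_ge0 x); rewrite (_ : 4`!%:R = 24 :> R)//; lra.
Qed.

(** Three regimes share one bound: [s] too small for the expansion, all coordinates of [y] within
    [s * L], and some coordinate beyond. The exponentials on the right pay for the first and the
    third. *)
Lemma transport_cost_pointwise n (K L s : R) (y t : 'rV[R]_n) :
  1 <= K -> 1 <= L -> 1 <= s -> s ^+ 16 <= expR L ->
  (K * L <= s -> (forall i, `|y ord0 i| <= s * L) ->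
    forall i, `|Num.sqrt (s ^+ 2 + 1) * t ord0 i - y ord0 i| <= 2 * K * (L ^+ 2 / s ^+ 2)) ->
  forall i, (Num.sqrt (s ^+ 2 + 1) * t ord0 i - y ord0 i) ^+ 2 <=
    112 * K ^+ 6 * (L ^+ 6 / s ^+ 4) *
     (1 + \sum_j expR `|y ord0 j / s| + expR `|t ord0 i|).
Proof.
move=> K1 L1 s1 sL close i.
set u := _ * _ - _; set E := \sum_j _; set G := expR _.
have s0 : 0 < s by exact: lt_le_trans s1.
have K6 : 1 <= K ^+ 6 by rewrite exprn_ege1.
have L6 : 1 <= L ^+ 6 by rewrite exprn_ege1.
have G0 : 0 <= G by exact: expR_ge0.
have E0 : 0 <= E by apply: sumr_ge0 => j _; exact: expR_ge0.
have EE j : expR `|y ord0 j / s| <= E.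
  by rewrite /E (bigD1 j)//= lerDl sumr_ge0// => k _; exact: expR_ge0.
(* The square of a difference is at most twice the sum of the squares, and
   [s ^+ 2 + 1 <= 2 * s ^+ 2]. *)
have u2 : u ^+ 2 <= 4 * (s ^+ 2 * t ord0 i ^+ 2) + 2 * (s ^+ 2 * (y ord0 i / s) ^+ 2).
  have -> : s ^+ 2 * (y ord0 i / s) ^+ 2 = y ord0 i ^+ 2.
    by rewrite exprMn exprVn mulrCA divff ?mulr1// gt_eqF// exprn_gt0.
  have r2 : Num.sqrt (s ^+ 2 + 1) ^+ 2 = s ^+ 2 + 1.
    by rewrite sqr_sqrtr// addr_ge0// sqr_ge0.
  have ss : 1 <= s ^+ 2 by rewrite exprn_ege1.
  have h : (Num.sqrt (s ^+ 2 + 1) * t ord0 i) ^+ 2 <= 2 * (s ^+ 2 * t ord0 i ^+ 2).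
    rewrite exprMn r2; have := sqr_ge0 (t ord0 i); nra.
  have := sqr_ge0 (Num.sqrt (s ^+ 2 + 1) * t ord0 i + y ord0 i).
  by rewrite /u; move: h; set p := _ * t _ _; nra.
have t2 : t ord0 i ^+ 2 <= 2 * G by exact: sqr_le_expR.
have y2 : (y ord0 i / s) ^+ 2 <= 2 * E.
  by rewrite (le_trans (sqr_le_expR _))// ler_pM2l.
have t4 : t ord0 i ^+ 4 <= 24 * G by exact: expr4_le_expR.
have y4 : (y ord0 i / s) ^+ 4 <= 24 * E.
  by rewrite (le_trans (expr4_le_expR _))// ler_pM2l.
have s20 : 0 < s ^+ 2 by rewrite exprn_gt0.
have s40 : 0 < s ^+ 4 by rewrite exprn_gt0.
have s4i : 0 < (s ^+ 4)^-1 by rewrite invr_gt0.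
have -> : 112 * K ^+ 6 * (L ^+ 6 / s ^+ 4) * (1 + E + G) =
    112 * K ^+ 6 * L ^+ 6 * (1 + E + G) / s ^+ 4 by rewrite mulrA [RHS]mulrAC.
rewrite ler_pdivlMr//.
(* For [s < K * L] the crude bound of order [s ^+ 2] is enough, since [s ^+ 6 <= (K * L) ^+ 6]. The
   sixth powers in the statement come from here. *)
have [KLs|KLs] := leP (K * L) s; last first.
  have : u ^+ 2 <= s ^+ 2 * (8 * (E + G)) by nra.
  move=> /(ler_wpM2r (ltW s40)) /le_trans; apply.
  have -> : s ^+ 2 * (8 * (E + G)) * s ^+ 4 = s ^+ 6 * (8 * (E + G)) by ring.
  have -> : 112 * K ^+ 6 * L ^+ 6 * (1 + E + G) = (K * L) ^+ 6 * (112 * (1 + E + G)) by rewrite exprMn; ring.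
  apply: ler_pM; rewrite ?exprn_ge0// ?mulr_ge0 ?addr_ge0 ?(ltW s0)//.
    by rewrite lerXn2r ?nnegrE ?(ltW s0) ?(ltW KLs)// (le_trans (ltW s0))// ltW.
  lra.
have KL6 : 1 <= K ^+ 6 * L ^+ 6 by rewrite mulr_ege1.
have [/forallP good|] := boolP [forall j, `|y ord0 j| <= s * L].
  have := close KLs good i; rewrite -/u => h.
  have : u ^+ 2 * s ^+ 4 <= (2 * K * L ^+ 2) ^+ 2.
    have -> : u ^+ 2 * s ^+ 4 = (`|u| * s ^+ 2) ^+ 2.
      by rewrite exprMn real_normK ?num_real// -exprM.
    have us : `|u| * s ^+ 2 <= 2 * K * L ^+ 2 by rewrite -ler_pdivlMr// -[leRHS]mulrA.
    have us0 : 0 <= `|u| * s ^+ 2 by rewrite mulr_ge0// ltW.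
    by rewrite lerXn2r// nnegrE// (le_trans us0).
  move=> /le_trans; apply.
  have -> : (2 * K * L ^+ 2) ^+ 2 = 4 * (K ^+ 2 * L ^+ 4) by ring.
  have : K ^+ 2 * L ^+ 4 <= K ^+ 6 * L ^+ 6.
    by apply: ler_pM; rewrite ?exprn_ge0 ?(le_trans _ K1) ?(le_trans _ L1)// ler_weXn2l.
  rewrite -[112 * _ * _]mulrA.
  move: (K ^+ 2 * _) (K ^+ 6 * _) KL6 => a b b1 ab.
  by nra.
(* A coordinate with [|y_j| > s * L] forces [E >= expR L >= s ^+ 16]. *)
move=> /forallPn[j]; rewrite -ltNge => bad.
have sE : s ^+ 16 <= E.
  rewrite (le_trans sL)// (le_trans _ (EE j))// ler_expR normrM.
  by rewrite [X in _ * X]gtr0_norm ?invr_gt0// ler_pdivlMr// mulrC ltW.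
(* The arithmetic-geometric mean inequality splits [x ^+ 2 * s ^+ 6] into [x ^+ 4], bounded by an
   exponential, and [s ^+ 12], bounded by [E]. *)
have young (x H : R) : x ^+ 4 <= 24 * H -> 0 <= H -> x ^+ 2 * s ^+ 6 <= E / 2 + 12 * H.
  move=> x4 H0.
  have s60 : 0 < s ^+ 6 by rewrite exprn_gt0.
  have h1 : 2 * (x ^+ 2 * s ^+ 6) <= x ^+ 4 + s ^+ 12.
    have := sqr_ge0 (x ^+ 2 - s ^+ 6).
    by rewrite sqrrB -!exprM; lra.
  have : s ^+ 12 <= s ^+ 16 by rewrite ler_weXn2l.
  lra.
have := young _ _ t4 G0; have := young _ _ y4 E0.
have := ler_wpM2r (ltW s40) u2.
have -> : (4 * (s ^+ 2 * t ord0 i ^+ 2) + 2 * (s ^+ 2 * (y ord0 i / s) ^+ 2)) * s ^+ 4 =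
  4 * (t ord0 i ^+ 2 * s ^+ 6) + 2 * ((y ord0 i / s) ^+ 2 * s ^+ 6) by ring.
move=> h1 h2 h3; rewrite (le_trans h1)//.
rewrite -[112 * _ * _]mulrA.
move: (K ^+ 6 * _) KL6 => b b1; nra.
Qed.

(** Integrate the pointwise bound. [F(Y)] is standard normal, so its exponential moment is at most
    4; as [Y / s] is [X / s + z] with [s >= 1], that of [Y / s] is at most [4 * expR beta]. The 5 is
    1 plus the former. *)
Lemma transport_cost_le d (T : measurableType d) (P : probability T R) n
    (X : T -> 'rV[R]_n) (F : 'rV[R]_n -> 'rV[R]_n) (beta K L s : R) :
  measurable_fun setT X -> (forall w i, `|X w ord0 i| <= beta) ->
  measurable_fun setT F -> gauss_transport P X s F ->
  1 <= K -> 1 <= L -> 1 <= s -> s ^+ 16 <= expR L ->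
  (forall y : 'rV[R]_n, K * L <= s -> (forall i, `|y ord0 i| <= s * L) ->
    forall i, `|Num.sqrt (s ^+ 2 + 1) * F y ord0 i - y ord0 i| <=
      2 * K * (L ^+ 2 / s ^+ 2)) ->
  (\int[P \x std_normal R n]_p (\sum_i (Num.sqrt (s ^+ 2 + 1) *
      F (X p.1 + s *: p.2) ord0 i - (X p.1 + s *: p.2) ord0 i) ^+ 2)%:E <=
   (112 * K ^+ 6 * (L ^+ 6 / s ^+ 4) * (n%:R * (5 + n%:R * (4 * expR beta))))%:E)%E.
Proof.
move=> mX Xb mF Ftr K1 L1 s1 sL close.
have s0 : 0 < s by exact: lt_le_trans s1.
pose m := (P \x std_normal R n)%E.
pose Y (p : T * 'rV[R]_n) := X p.1 + s *: p.2.
have mY : measurable_fun setT Y.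
  apply: measurable_fun_rVD; first exact: measurableT_comp.
  exact: measurable_fun_rVZ.
have mYi i : measurable_fun setT (fun p => Y p ord0 i) by exact: measurable_fun_coord.
have mFY : measurable_fun setT (fun p => F (Y p)) by exact: measurableT_comp.
have mFYi i : measurable_fun setT (fun p => F (Y p) ord0 i) by exact: measurable_fun_coord.
pose E j p : \bar R := (expR `|Y p ord0 j / s|)%:E.
pose G i p : \bar R := (expR `|F (Y p) ord0 i|)%:E.
have E0 j p : (0 <= E j p)%E by rewrite lee_fin expR_ge0.
have G0 j p : (0 <= G j p)%E by rewrite lee_fin expR_ge0.
have mexp d1 (T1 : measurableType d1) (f : T1 -> R) : measurable_fun setT f ->
    measurable_fun setT (fun t => (expR `|f t|)%:E).
  by move=> mf; apply/measurable_EFinP; do 2 apply: measurableT_comp => //.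
have mE j : measurable_fun setT (E j).
  by apply: mexp; exact: measurable_funM.
have mG i : measurable_fun setT (G i) by exact: mexp.
have iE j : (\int[m]_p E j p <= (4 * expR beta)%:E)%E.
  rewrite /m fubini_tonelli1// /fubini_F/=.
  apply: (@le_trans _ _ (\int[P]_w (4 * expR beta)%:E))%E; last first.
    by rewrite integral_cst//= probability_setT mule1.
  apply: ge0_le_integral => //.
  - by move=> w _; exact: integral_ge0.
  - exact: (measurable_fun_fubini_tonelli_F (E j)).
  - move=> w _; apply: (@le_trans _ _
      (\int[std_normal R n]_z ((expR beta)%:E * (expR `|z ord0 j|)%:E)))%E.
      apply: ge0_le_integral => //.
      + exact: (measurableT_comp (mE j) (measurable_pair1 w)).
      + apply: emeasurable_funM => //; apply: mexp; exact: measurable_coord.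
      + move=> z _; rewrite -EFinM lee_fin -expRD ler_expR /Y/= !mxE.
        rewrite mulrDl [X in _ + X]mulrAC divff ?gt_eqF// mul1r.
        rewrite (le_trans (ler_normD _ _))// lerD2r normrM (gtr0_norm (_ : 0 < s^-1)) ?invr_gt0//.
        by rewrite ler_pdivrMr// (le_trans (Xb _ _))// ler_peMr// (le_trans _ (Xb w j)).
    rewrite ge0_integralZl//.
    + by rewrite mulrC EFinM lee_wpmul2l ?lee_fin ?expR_ge0// integral_std_normal_expR_norm.
    + by apply: mexp; exact: measurable_coord.
have iG i : (\int[m]_p G i p <= 4%:E)%E.
  rewrite /m fubini_tonelli1// /fubini_F/=.
  have mi : measurable_fun setT (fun z : 'rV[R]_n => (expR `|z ord0 i|)%:E).
    by apply: mexp; exact: measurable_coord.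
  have h := Ftr (fun z => (expR `|z ord0 i|)%:E) mi (fun z => expR_ge0 _).
  apply: le_trans (integral_std_normal_expR_norm i).
  by rewrite -h.
pose c : R := 112 * K ^+ 6 * (L ^+ 6 / s ^+ 4).
have c0 : 0 <= c.
  by rewrite /c !mulr_ge0 ?invr_ge0 ?exprn_ge0// ltW// ?(lt_le_trans _ K1)// (lt_le_trans _ L1).
pose H i p := (1 + \sum_j E j p + G i p)%E.
have H0 i p : (0 <= H i p)%E.
  by rewrite /H !adde_ge0// sume_ge0.
have msE : measurable_fun setT (fun p => \sum_j E j p)%E by exact: emeasurable_sum.
have mH i : measurable_fun setT (H i).
  by apply: emeasurable_funD => //; exact: emeasurable_funD.
have iH i : (\int[m]_p H i p <= (5 + n%:R * (4 * expR beta))%:E)%E.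
  rewrite /H ge0_integralD//; last 2 first.
  - by move=> p _; rewrite adde_ge0// sume_ge0.
  - exact: emeasurable_funD.
  rewrite ge0_integralD//; last by move=> p _; rewrite sume_ge0.
  rewrite integral_cst//= probability_setT mule1 ge0_integral_sum//.
  have -> : (5 + n%:R * (4 * expR beta))%:E = (1%:E + (n%:R * (4 * expR beta))%:E + 4%:E)%E :> \bar R.
    by rewrite -!EFinD; congr (_%:E); ring.
  apply: leeD => //; apply: leeD => //.
  rewrite (@le_trans _ _ (\sum_(j < n) (4 * expR beta)%:E)%E)//; first exact: lee_sum.
  by rewrite sumEFin sumr_const card_ord -[X in (X%:E <= _)%E]mulr_natl.
apply: (@le_trans _ _ (\int[m]_p (c%:E * \sum_i H i p)))%E.
  apply: ge0_le_integral => //.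
  - by move=> p _; rewrite lee_fin sumr_ge0// => i _; rewrite sqr_ge0.
  - apply/measurable_EFinP; apply: measurable_sum => i; apply: measurable_funX.
    by apply: measurable_funB => //; exact: measurable_funM.
  - by apply: emeasurable_funM => //; exact: emeasurable_sum.
  - move=> p _; rewrite /H /E /G.
    have -> : (\sum_i (1 + \sum_j (expR `|Y p ord0 j / s|)%:E + (expR `|F (Y p) ord0 i|)%:E) =
       (\sum_(i < n) (1 + \sum_(j < n) expR `|Y p ord0 j / s| + expR `|F (Y p) ord0 i|)%R)%:E)%E.
      by rewrite -sumEFin; apply: eq_bigr => i _; rewrite sumEFin -!EFinD.
    rewrite -EFinM lee_fin mulr_sumr; apply: ler_sum => i _.
    by apply: transport_cost_pointwise => //; exact: close.
rewrite ge0_integralZl//; last 2 first.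
- exact: emeasurable_sum.
- by move=> p _; rewrite sume_ge0.
rewrite -/c [leRHS]EFinM lee_wpmul2l ?lee_fin// ge0_integral_sum//.
rewrite (@le_trans _ _ (\sum_(j < n) (5 + n%:R * (4 * expR beta))%:E)%E)//; first exact: lee_sum.
by rewrite sumEFin sumr_const card_ord -[X in (X%:E <= _)%E]mulr_natl.
Qed.

End transport_cost.

(** * Laws of partial sums *)

Section partial_sum_law.
Local Open Scope ereal_scope.
Context d (T : measurableType d) (R : realType) (P : probability T R) (n : nat).
Variable eta : nat -> {RV P >-> 'rV[R]_n}.

Definition partial_sum (m : nat) (w : T) : 'rV[R]_n := (\sum_(i < m) eta i w)%R.

Lemma measurable_partial_sum m : measurable_fun setT (partial_sum m).
Proof.
elim: m => [|m IH].
  by rewrite (_ : partial_sum 0 = cst 0%R)//; apply/funext => w; rewrite /partial_sum big_ord0.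
rewrite (_ : partial_sum m.+1 = fun w => (partial_sum m w + eta m w)%R).
  exact: measurable_fun_rVD.
by apply/funext => w; rewrite /partial_sum big_ord_recr.
Qed.

HB.instance Definition _ m :=
  isMeasurableFun.Build _ _ _ _ (partial_sum m) (measurable_partial_sum m).

Hypothesis eta_indep : mutually_independent eta.

Let cylinder (B : nat -> set 'rV[R]_n) (s : seq nat) : set T :=
  \bigcap_(i in [set` s]) (eta i @^-1` B i).

Let cylinder_nil B : cylinder B [::] = setT.
Proof. by apply/seteqP; split. Qed.

Let cylinder_cons B i s : cylinder B (i :: s) = eta i @^-1` B i `&` cylinder B s.
Proof.
apply/seteqP; split=> w /=.
  move=> h; split; first by apply: h; rewrite /= mem_head.
  by move=> j js; apply: h; rewrite /= in_cons [j \in s]js orbT.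
move=> [h1 h2] j /=; rewrite in_cons => /predU1P[->//|js]; exact: h2.
Qed.

Let meta i (B : set 'rV[R]_n) : measurable B -> measurable (eta i @^-1` B).
Proof. by move=> mB; rewrite -[X in measurable X]setTI; exact: measurable_funP. Qed.

Let mcylinder B s : (forall i, measurable (B i)) -> measurable (cylinder B s).
Proof.
move=> mB; elim: s => [|i s IH]; last first.
  by rewrite cylinder_cons; apply: measurableI => //; exact: meta.
by rewrite cylinder_nil.
Qed.

Let cylinder_indep B i s : (forall j, measurable (B j)) -> uniq (i :: s) ->
  P (cylinder B (i :: s)) = P (eta i @^-1` B i) * P (cylinder B s).
Proof.
move=> mB us; rewrite /cylinder !eta_indep ?big_cons//.
by case/andP: us.
Qed.

(** Independence from [eta m] alone would not pass through the induction, so all cylinders over the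
    later indices [m, ..., m + k - 1] are included. *)
Let indep_at m := forall k (B : nat -> set 'rV[R]_n) (A : set 'rV[R]_n),
  (forall i, measurable (B i)) -> measurable A ->
  P (partial_sum m @^-1` A `&` cylinder B (iota m k)) =
  P (partial_sum m @^-1` A) * P (cylinder B (iota m k)).

Let mpair m : measurable_fun setT (fun w => (partial_sum m w, eta m w)).
Proof. by apply: measurable_fun_pair => //; exact: measurable_partial_sum. Qed.

(** On the event [C], the law of the pair and [P C] times the product of the laws agree on
    rectangles, hence everywhere. Scaling by [P C] avoids conditioning on an event that may be
    null. *)
Let indep_at_pair m : indep_at m -> forall k (B : nat -> set 'rV[R]_n) D,
  (forall i, measurable (B i)) -> measurable D ->
  P ((fun w => (partial_sum m w, eta m w)) @^-1` D `&` cylinder B (iota m.+1 k)) =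
  P (cylinder B (iota m.+1 k)) *
  (distribution P (partial_sum m) \x distribution P (eta m)) D.
Proof.
move=> im k B D mB mD.
set C := cylinder B _; have mC : measurable C by exact: mcylinder.
have q0 : (0 <= fine (P C))%R by exact: fine_ge0.
have qE : P C = (fine (P C))%:E by rewrite fineK// fin_num_measure.
have numE : (NngNum q0)%:num%:E = P C by exact: esym qE.
pose g : {mfun T >-> ('rV[R]_n * 'rV[R]_n)%type} :=
  HB.pack (fun w => (partial_sum m w, eta m w)) (isMeasurableFun.Build _ _ _ _ _ (mpair m)).
pose m1 := mscale (NngNum q0) (distribution P (partial_sum m)).
have m1E A : m1 A = P C * distribution P (partial_sum m) A.
  by rewrite -numE.
have /(_ D mD) : forall X : set ('rV[R]_n * 'rV[R]_n), measurable X ->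
    (m1 \x distribution P (eta m)) X = pushforward (mrestr P mC) g X.
  apply: product_measure_unique => A A' mA mA'.
  (* With [A'] in slot [m], the second side of the rectangle and [C] merge into one cylinder over
     [iota m k.+1], to which [im] applies. *)
  pose B' i := if i == m then A' else B i.
  have mB' i : measurable (B' i) by rewrite /B'; case: ifP.
  have CE : cylinder B' (iota m.+1 k) = C.
    rewrite /C /cylinder; apply: eq_bigcapr => i /=; rewrite mem_iota /B'.
    by case: eqP => // -> /andP[]; rewrite ltnn.
  have C'E : cylinder B' (iota m k.+1) = eta m @^-1` A' `&` C.
    by rewrite /= cylinder_cons CE /B' eqxx.
  have := im k.+1 B' A mB' mA; rewrite C'E.
  have -> : P (eta m @^-1` A' `&` C) = P (eta m @^-1` A') * P C.
    rewrite -C'E /= cylinder_indep//; last by have := iota_uniq m k.+1.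
    by rewrite CE /B' eqxx.
  rewrite setIA => h.
  apply: (etrans h).
  transitivity (P C * distribution P (partial_sum m) A * distribution P (eta m) A').
    by rewrite muleA [LHS]muleC muleA.
  by rewrite -m1E.
move=> h; apply: (etrans (esym h)).
rewrite /product_measure1 /m1 ge0_integral_mscale//; last first.
  exact: measurable_fun_xsection.
by rewrite numE.
Qed.

Lemma partial_sum_indep m : indep_at m.
Proof.
elim: m => [|m IH] k B A mB mA.
  have E0 w : partial_sum 0 w = 0%R by rewrite /partial_sum big_ord0.
  have [A0|A0] := pselect (A 0%R).
    rewrite (_ : _ @^-1` A = setT) ?setTI ?probability_setT ?mul1e//.
    by apply/seteqP; split=> // w _; rewrite /= E0.
  rewrite (_ : _ @^-1` A = set0) ?set0I ?measure0 ?mul0e//.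
  by apply/seteqP; split=> // w; rewrite /= E0.
pose D := [set p : 'rV[R]_n * 'rV[R]_n | A (p.1 + p.2)%R].
have mD : measurable D.
  rewrite -[X in measurable X]setTI.
  exact: (measurable_fun_rVD measurable_fst measurable_snd).
have SD : partial_sum m.+1 @^-1` A = (fun w => (partial_sum m w, eta m w)) @^-1` D.
  by apply/seteqP; split=> w; rewrite /= /partial_sum /D/= big_ord_recr.
have h0 := indep_at_pair IH 0 mB mD.
rewrite SD indep_at_pair// muleC; congr (_ * _).
move: h0; rewrite cylinder_nil setIT => ->.
by rewrite probability_setT mul1e.
Qed.

Lemma partial_sumS_law m (A : set 'rV[R]_n) : measurable A ->
  distribution P (partial_sum m.+1) A =
  \int[distribution P (eta m)]_y
     distribution P (partial_sum m) [set x | A (x + y)%R].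
Proof.
move=> mA.
pose D := [set p : 'rV[R]_n * 'rV[R]_n | A (p.1 + p.2)%R].
have mD : measurable D.
  rewrite -[X in measurable X]setTI.
  exact: (measurable_fun_rVD measurable_fst measurable_snd).
have SD : partial_sum m.+1 @^-1` A = (fun w => (partial_sum m w, eta m w)) @^-1` D.
  by apply/seteqP; split=> w; rewrite /= /partial_sum /D/= big_ord_recr.
have mB (i : nat) : measurable ((fun=> setT) i : set 'rV[R]_n) by [].
have := indep_at_pair (@partial_sum_indep m) 0 mB mD.
rewrite cylinder_nil setIT probability_setT mul1e => h.
pose mu := distribution P (partial_sum m); pose nu := distribution P (eta m).
transitivity ((mu \x nu) D); first by rewrite -h -SD.
transitivity (\int[mu \x nu]_p (\1_D p)%:E); first by rewrite integral_indic// setIT.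
have m1D : measurable_fun setT (fun p => (\1_D p)%:E : \bar R).
  by apply/measurable_EFinP; exact: measurable_indic.
rewrite fubini_tonelli2//; apply: eq_integral => y _; rewrite /fubini_G.
have mDy : measurable [set x | A (x + y)%R].
  have mDy : measurable_fun setT (fun x : 'rV[R]_n => x + y)%R.
    by apply: measurable_fun_rVD => //; exact: measurable_id.
  by rewrite -[X in measurable X]setTI; exact: mDy.
have -> : distribution P (partial_sum m) [set x | A (x + y)%R] =
    \int[mu]_x (\1_[set x | A (x + y)%R] x)%:E by rewrite integral_indic// setIT.
by [].
Qed.

End partial_sum_law.

(** * The coupling recursion *)

Section coupling_step.
Local Open Scope ereal_scope.
Context d (T : measurableType d) (R : realType) (P : probability T R) (n : nat).
Implicit Types (mu : probability 'rV[R]_n R)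
  (gamma : probability ('rV[R]_n * 'rV[R]_n)%type R).

(** The sum is compared with [s] times a standard normal vector, so that errors simply add;
    normalization is left to the end. *)
Definition scaled_cost gamma (s : R) : \bar R :=
  \int[gamma]_z (\sum_i (z.1 ord0 i - s * z.2 ord0 i) ^+ 2)%:E.

Lemma measurable_scaled_cost (s : R) : measurable_fun setT
  (fun z : 'rV[R]_n * 'rV[R]_n => \sum_i (z.1 ord0 i - s * z.2 ord0 i) ^+ 2)%R.
Proof.
apply: measurable_sum => i; apply: measurable_funX; apply: measurable_funB.
  by apply: measurable_fun_coord; exact: measurable_fst.
by apply: measurable_funM => //; apply: measurable_fun_coord; exact: measurable_snd.
Qed.

Lemma ge0_integral_snd_coupling gamma mu nu (h : 'rV[R]_n -> \bar R) :
  couplings mu nu gamma -> measurable_fun setT h -> (forall x, 0 <= h x) ->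
  \int[gamma]_z h z.2 = \int[nu]_x h x.
Proof.
move=> cg mh h0.
pose f : {mfun ('rV[R]_n * 'rV[R]_n)%type >-> 'rV[R]_n} :=
  HB.pack (fun z : 'rV[R]_n * 'rV[R]_n => z.2)
    (isMeasurableFun.Build _ _ _ _ _ measurable_snd).
rewrite -(@ge0_integral_distribution _ _ _ _ _ gamma f h mh h0).
apply: eq_measure_integral => A mA _.
have [_ h2] := cg A mA; apply: etrans h2; rewrite /= /distribution /pushforward; congr (gamma _).
by apply/seteqP; split=> -[x y] //= [].
Qed.

(** If [(S, Z)] has law [gamma] and [X] is independent of it, the new pair is [(S + X, F(X + s Z))].
    Its error is [S - s Z] minus [r F(Y) - Y] with [Y = X + s Z], and the first marginal is the
    convolution in the hypothesis on [mu']. *)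
Lemma coupling_step mu mu' gamma (X : T -> 'rV[R]_n) (F : 'rV[R]_n -> 'rV[R]_n)
    (s r a b : R) :
  (forall A, measurable A -> mu' A = \int[P]_w mu [set x | A (x + X w)%R]) ->
  couplings mu (std_normal R n) gamma ->
  measurable_fun setT X -> measurable_fun setT F -> gauss_transport P X s F ->
  (0 < a)%R -> (0 < b)%R -> scaled_cost gamma s <= (a ^+ 2)%:E ->
  \int[P \x std_normal R n]_p (\sum_i (r * F (X p.1 + s *: p.2) ord0 i -
      (X p.1 + s *: p.2) ord0 i) ^+ 2)%:E <= (b ^+ 2)%:E ->
  exists2 gamma', couplings mu' (std_normal R n) gamma' &
    scaled_cost gamma' r <= ((a + b) ^+ 2)%:E.
Proof.
move=> mu'E cg mX mF Ftr a0 b0 costa costb.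
pose V : measurableType _ := 'rV[R]_n.
pose Y (q : V * V * T) : V := (X q.2 + s *: q.1.2)%R.
have mY : measurable_fun setT Y.
  apply: measurable_fun_rVD; first exact: measurableT_comp.
  by apply: measurable_fun_rVZ; exact: measurableT_comp.
pose g (q : V * V * T) : V * V := ((q.1.1 + X q.2)%R, F (Y q)).
have mg1 : measurable_fun setT (fun q : V * V * T => (q.1.1 + X q.2)%R : V).
  by apply: measurable_fun_rVD; exact: measurableT_comp.
have mFY : measurable_fun setT (fun q => F (Y q)) by exact: measurableT_comp.
have mg : measurable_fun setT g by exact: measurable_fun_pair.
pose g' : {mfun (V * V * T)%type >-> (V * V)%type} :=
  HB.pack g (isMeasurableFun.Build _ _ _ _ _ mg).
pose m := gamma \x P.
have mind (A : set V) : measurable A -> measurable_fun setT (fun x => (\1_A x)%:E : \bar R).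
  by move=> mA; apply/measurable_EFinP; exact: measurable_indic.
exists (distribution m g').
  move=> A mA; split.
    rewrite mu'E//.
    transitivity (\int[m]_q (\1_A (q.1.1 + X q.2)%R)%:E).
      rewrite [LHS](_ : _ = m ((fun q => (q.1.1 + X q.2)%R) @^-1` A)); last first.
        by congr (m _); apply/seteqP; split=> q //= [].
      rewrite (_ : (fun q => _) = fun q => (\1_((fun q : V * V * T => (q.1.1 + X q.2)%R) @^-1` A) q)%:E)//.
      rewrite integral_indic ?setIT//.
      by rewrite -[X in measurable X]setTI; exact: mg1.
    rewrite /m fubini_tonelli2//; last exact: (measurableT_comp (mind A mA)).
    apply: eq_integral => w _; rewrite /fubini_G/=.
    have mAw : measurable [set x : V | A (x + X w)%R].
      have h : measurable_fun setT (fun x : V => x + X w)%R.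
        by apply: measurable_fun_rVD => //; exact: measurable_id.
      by rewrite -[X in measurable X]setTI; exact: h.
    have [<- _] := cg _ mAw.
    rewrite (_ : (fun z => _) = fun z : V * V =>
        (\1_([set x : V | A (x + X w)%R] `*` setT) z)%:E); last first.
      apply/funext => z; rewrite !indicE; congr ((nat_of_bool _)%:R%:E).
      by apply/idP/idP; rewrite !inE => // -[].
    by rewrite integral_indic ?setIT//; exact: measurableX.
  transitivity (\int[m]_q (\1_A (F (Y q)))%:E).
    rewrite [LHS](_ : _ = m ((fun q => F (Y q)) @^-1` A)); last first.
      by congr (m _); apply/seteqP; split=> q //= [].
    rewrite (_ : (fun q => _) = fun q => (\1_((fun q => F (Y q)) @^-1` A) q)%:E)//.
    rewrite integral_indic ?setIT//.
    by rewrite -[X in measurable X]setTI; exact: mFY.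
  rewrite /m fubini_tonelli2//; last exact: (measurableT_comp (mind A mA)).
  transitivity (\int[P]_w \int[std_normal R n]_z (\1_A (F (X w + s *: z)%R))%:E).
    apply: eq_integral => w _; rewrite /fubini_G/=.
    apply: (ge0_integral_snd_coupling (h := fun z => (\1_A (F (X w + s *: z)%R))%:E) cg) => //.
    apply: (measurableT_comp (mind A mA)); apply: (measurableT_comp mF).
    by apply: measurable_fun_rVD => //; apply: measurable_fun_rVZ; exact: measurable_id.
  rewrite (Ftr (fun x => (\1_A x)%:E)) ?integral_indic ?setIT//.
  exact: mind.
rewrite /scaled_cost ge0_integral_distribution//; last 2 first.
- by apply/measurable_EFinP; exact: measurable_scaled_cost.
- by move=> z; rewrite lee_fin sumr_ge0// => i _; exact: sqr_ge0.
pose f1 (q : V * V * T) := (\sum_i (q.1.1 ord0 i - s * q.1.2 ord0 i) ^+ 2)%R.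
pose f2 (q : V * V * T) := (\sum_i (r * F (Y q) ord0 i - Y q ord0 i) ^+ 2)%R.
have mf1 : measurable_fun setT f1.
  exact: (measurableT_comp (measurable_scaled_cost s) measurable_fst).
have mf2 : measurable_fun setT f2.
  apply: measurable_sum => i; apply: measurable_funX; apply: measurable_funB.
    by apply: measurable_funM => //; exact: measurable_fun_coord.
  exact: measurable_fun_coord.
have f10 q : (0 <= f1 q)%R by apply: sumr_ge0 => i _; exact: sqr_ge0.
have f20 q : (0 <= f2 q)%R by apply: sumr_ge0 => i _; exact: sqr_ge0.
(* Minkowski's inequality in squared form: [(u - v) ^ 2 <= (1 + b / a) u ^ 2 + (1 + a / b) v ^ 2],
   with the weights for which costs [a ^ 2] and [b ^ 2] add up to [(a + b) ^ 2]. *)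
have ba0 : (0 <= 1 + b / a)%R by rewrite addr_ge0// divr_ge0// ltW.
have ab0 : (0 <= 1 + a / b)%R by rewrite addr_ge0// divr_ge0// ltW.
apply: (@le_trans _ _ (\int[m]_q ((1 + b / a)%:E * (f1 q)%:E + (1 + a / b)%:E * (f2 q)%:E))).
  apply: ge0_le_integral => //.
  - by move=> q _; rewrite lee_fin sumr_ge0// => i _; exact: sqr_ge0.
  - apply/measurable_EFinP.
    exact: (measurableT_comp (measurable_scaled_cost r) mg).
  - by apply: emeasurable_funD; apply: emeasurable_funM => //; exact/measurable_EFinP.
  move=> q _; rewrite -!EFinM -EFinD lee_fin !mulr_sumr -big_split/=.
  apply: ler_sum => i _; rewrite /g/=.
  set u := (q.1.1 ord0 i - s * q.1.2 ord0 i)%R; set v := (r * F (Y q) ord0 i - Y q ord0 i)%R.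
  have -> : ((q.1.1 + X q.2) ord0 i - r * F (Y q) ord0 i = u - v)%R.
    by rewrite /u /v /Y !mxE; ring.
  rewrite -subr_ge0.
  have -> : ((1 + b / a) * u ^+ 2 + (1 + a / b) * v ^+ 2 - (u - v) ^+ 2 =
     (b * u + a * v) ^+ 2 / (a * b))%R by field; rewrite !gt_eqF.
  by rewrite divr_ge0 ?sqr_ge0// mulr_ge0// ltW.
have mE1 : measurable_fun setT (fun q => (f1 q)%:E) by exact/measurable_EFinP.
have mE2 : measurable_fun setT (fun q => (f2 q)%:E) by exact/measurable_EFinP.
rewrite ge0_integralD//; last 4 first.
- by move=> q _; rewrite mule_ge0// lee_fin.
- exact: emeasurable_funM.
- by move=> q _; rewrite mule_ge0// lee_fin.
- exact: emeasurable_funM.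
rewrite !ge0_integralZl//; try by move=> q _; rewrite lee_fin.
have -> : ((a + b) ^+ 2)%:E = (1 + b / a)%:E * (a ^+ 2)%:E + (1 + a / b)%:E * (b ^+ 2)%:E.
  by rewrite -!EFinM -EFinD; congr (_%:E); field; rewrite !gt_eqF.
apply: leeD; apply: lee_wpmul2l; rewrite ?lee_fin//.
  apply: le_trans costa; rewrite /m fubini_tonelli1//.
  rewrite /fubini_F /f1/= /scaled_cost le_eqVlt; apply/orP; left; apply/eqP.
  by apply: eq_integral => z _; rewrite integral_cst//= probability_setT mule1.
(* [f2] involves only [X] and the second component of [gamma], whose law is standard normal. *)
apply: le_trans costb; rewrite /m fubini_tonelli2//.
rewrite le_eqVlt; apply/orP; left; apply/eqP.
pose k w (z : V) := (\sum_i (r * F (X w + s *: z) ord0 i - (X w + s *: z) ord0 i) ^+ 2)%R.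
have k0 w z : (0 <= k w z)%R by apply: sumr_ge0 => i _; exact: sqr_ge0.
have mk : measurable_fun setT (fun p : T * V => (k p.1 p.2)%:E).
  have mY' : measurable_fun setT (fun p : T * V => X p.1 + s *: p.2)%R.
    apply: measurable_fun_rVD; first exact: measurableT_comp.
    exact: measurable_fun_rVZ.
  apply/measurable_EFinP; apply: measurable_sum => i; apply: measurable_funX.
  apply: measurable_funB; last exact: measurable_fun_coord.
  apply: measurable_funM => //; apply: measurable_fun_coord.
  exact: (measurableT_comp mF mY').
rewrite (fubini_tonelli1 (fun p : T * V => (k p.1 p.2)%:E))//; last first.
  by move=> p; rewrite lee_fin.
apply: eq_integral => w _; rewrite /fubini_G /fubini_F/=.
apply: (ge0_integral_snd_coupling (h := fun z => (k w z)%:E) cg) => //.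
  exact: (measurableT_comp mk (measurable_pair1 w)).
by move=> z; rewrite lee_fin; exact: k0.
Qed.

End coupling_step.

Section bounded_version.
Context d (T : measurableType d) (R : realType) (P : probability T R) (n : nat).

(** The exponential weights and the Taylor expansion call for a bound at every point. The vector is
    set to 0 on the null set where the bound fails. *)
Lemma bounded_version (e : {RV P >-> 'rV[R]_n}) (beta : R) :
  {ae P, forall w, enorm (e w) <= beta} ->
  exists X : T -> 'rV[R]_n, [/\ measurable_fun setT X,
    (forall w, \sum_i X w ord0 i ^+ 2 <= beta ^+ 2) &
    {ae P, forall w, X w = e w}].
Proof.
move=> ebeta.
pose q w := \sum_i e w ord0 i ^+ 2.
have mei i : measurable_fun setT (fun w => e w ord0 i) by exact: measurable_fun_coord.
have mq : measurable_fun setT q.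
  by apply: measurable_sum => i; exact: measurable_funX.
pose G := [set w | q w <= beta ^+ 2].
have mG : measurable G.
  rewrite -[X in measurable X]setTI (_ : G = (fun w => q w <= beta ^+ 2) @^-1` [set true]) //.
  exact: (measurable_fun_ler mq (measurable_cst _)).
exists (fun w => (\1_G w : R) *: e w); split.
- apply/measurable_fun_rVP => i; under eq_fun do rewrite mxE.
  by apply: measurable_funM => //; exact: measurable_indic.
- move=> w; rewrite indicE; have [wG|wG] := boolP (w \in G).
    by rewrite scale1r; move: wG; rewrite inE.
  by rewrite scale0r big1 ?sqr_ge0// => i _; rewrite mxE expr0n.
apply: filterS ebeta => w ew.
have e0 : 0 <= q w by apply: sumr_ge0 => i _; exact: sqr_ge0.
have s0 : 0 <= enorm (e w) by exact: sqrtr_ge0.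
have qE : q w = enorm (e w) ^+ 2 by rewrite /enorm sqr_sqrtr.
suff wG : q w <= beta ^+ 2 by rewrite indicE mem_set// scale1r.
by rewrite qE lerXn2r ?nnegrE// (le_trans s0).
Qed.

End bounded_version.

(** * Iterating the coupling step *)

Section coupling_rate.
Context d (T : measurableType d) (R : realType) (P : probability T R) (n : nat).
Variables (eta : nat -> {RV P >-> 'rV[R]_n}) (X : T -> 'rV[R]_n) (beta : R) (N : nat).
Hypothesis eta_iid : iid eta.
Hypotheses (mX : measurable_fun setT X) (Xeta : {ae P, forall w, X w = eta 0 w}).
Hypotheses (Xb : forall w i, `|X w ord0 i| <= beta) (beta1 : 1 <= beta).
Hypotheses (Xiso : isotropic P X) (nN : (n <= N)%N).

Let mu m : probability 'rV[R]_n R := distribution P (partial_sum eta m).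

(** The summands have the same law, so the single bounded version [X] of [eta 0] serves at every
    step. *)
Let integral_eta m (h : 'rV[R]_n -> \bar R) :
  measurable_fun setT h -> (forall x, 0 <= h x)%E ->
  (\int[distribution P (eta m)]_y h y = \int[P]_w h (X w))%E.
Proof.
move=> mh h0; transitivity (\int[distribution P (eta 0)]_y h y)%E.
  by apply: eq_measure_integral => A mA _; exact: eta_iid.2.
rewrite ge0_integral_distribution//; apply: ge0_ae_eq_integral => //.
- exact: measurableT_comp.
- exact: measurableT_comp.
- by move=> w _; exact: h0.
- by apply: filterS Xeta => w -> _.
Qed.

Let mu_rec m A : measurable A ->
  (mu m.+1 A = \int[P]_w mu m [set x | A (x + X w)%R])%E.
Proof.
move=> mA; apply: (etrans (partial_sumS_law eta_iid.1 m mA)).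
apply: (integral_eta m (h := fun y => distribution P (partial_sum eta m) [set x | A (x + y)])) => //.
pose D := [set p : 'rV[R]_n * 'rV[R]_n | A (p.1 + p.2)].
have mD : measurable D.
  rewrite -[X in measurable X]setTI.
  exact: (measurable_fun_rVD measurable_fst measurable_snd).
rewrite [X in measurable_fun _ X](_ : _ = distribution P (partial_sum eta m) \o ysection D); last first.
  by apply/funext => y /=; rewrite /ysection; congr (_ _); apply/seteqP; split=> x /=; rewrite inE.
exact: measurable_fun_ysection.
Qed.

(** The first summand is the constant of [transport_cost_le] with the dimension raised to [N], the
    second bounds the cost at time 1, and the last makes [c >= 1]. *)
Let c : R := 112 * knothe_const N beta ^+ 6 * (N%:R * (5 + N%:R * (4 * expR beta))) +
  N%:R * (2 * beta ^+ 2 + 16) + 1.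

Definition rate_const : R := c.

Let K := knothe_const N beta.

Let K1 : 1 <= K.
Proof.
have B0 : 0 <= N.+1%:R * beta ^+ 2 by rewrite mulr_ge0 ?sqr_ge0.
by have := exprn_ge0 3 B0; rewrite /K /knothe_const; lra.
Qed.

Let K0 : 0 <= K. Proof. exact: le_trans K1. Qed.

Let ca0 : 0 <= 112 * K ^+ 6 * (N%:R * (5 + N%:R * (4 * expR beta))).
Proof.
have K6 := exprn_ge0 6 K0; have e0 := expR_ge0 beta.
apply: mulr_ge0; first exact: mulr_ge0.
by do 2 (apply: mulr_ge0 => //; try apply: addr_ge0 => //); exact: mulr_ge0.
Qed.

Let cb0 : 0 <= N%:R * (2 * beta ^+ 2 + 16).
Proof. by rewrite mulr_ge0// addr_ge0// mulr_ge0// sqr_ge0. Qed.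

Let cE : c = 112 * K ^+ 6 * (N%:R * (5 + N%:R * (4 * expR beta))) +
  N%:R * (2 * beta ^+ 2 + 16) + 1.
Proof. by []. Qed.

Let c1 : 1 <= c.
Proof. by rewrite cE; have := ca0; have := cb0; lra. Qed.

(** The recursion starts at time 1, since a step needs [s > 0]. The independent coupling is enough:
    [(x - y) ^ 2 <= 2 x ^ 2 + 2 y ^ 2 <= 2 beta ^ 2 + 4 exp |y|]. *)
Lemma coupling_base : exists2 gamma, couplings (mu 1) (std_normal R n) gamma &
  (scaled_cost gamma 1 <= c%:E)%E.
Proof.
pose V : measurableType _ := 'rV[R]_n.
pose g (p : T * V) : V * V := (X p.1, p.2).
have mg : measurable_fun setT g.
  by apply: measurable_fun_pair => //=; exact: measurableT_comp.
pose g' : {mfun (T * V)%type >-> (V * V)%type} :=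
  HB.pack g (isMeasurableFun.Build _ _ _ _ _ mg).
have mu0 S : mu 0 S = (\1_S (0 : V))%:E.
  have E0 w' : partial_sum eta 0 w' = 0 by rewrite /partial_sum big_ord0.
  transitivity (P (partial_sum eta 0 @^-1` S)); first by [].
  rewrite indicE; have [S0|S0] := boolP (0 \in S).
    rewrite (_ : _ @^-1` _ = setT) ?probability_setT//.
    by apply/seteqP; split=> // w' _; rewrite /= E0; move: S0; rewrite inE.
  rewrite (_ : _ @^-1` _ = set0) ?measure0//.
  apply/seteqP; split=> // w'; rewrite /= E0 => S0'.
  by move: S0; rewrite notin_setE.
exists (distribution (P \x std_normal R n)%E g').
  move=> A mA; split.
    transitivity ((P \x std_normal R n)%E ((X @^-1` A) `*` [set: V])).
      by congr ((_ \x _)%E _); apply/seteqP; split=> p //=.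
    rewrite product_measure1E//; last by rewrite -[X in measurable X]setTI; exact: mX.
    rewrite [X in (_ * X)%E](_ : _ = 1%E) ?mule1; last exact: probability_setT.
    apply/esym/(etrans (mu_rec 0 mA))/esym.
    transitivity (\int[P]_w (\1_(X @^-1` A) w)%:E)%E.
      by rewrite integral_indic ?setIT// -[X in measurable X]setTI; exact: mX.
    apply: eq_integral => w _; apply: etrans (esym (mu0 _)).
    by rewrite !indicE; congr ((nat_of_bool _)%:R%:E); apply/idP/idP; rewrite !inE/= add0r.
  transitivity ((P \x std_normal R n)%E ([set: T] `*` A)).
    by congr ((_ \x _)%E _); apply/seteqP; split=> p //=.
  rewrite product_measure1E// [X in (X * _)%E](_ : _ = 1%E) ?mul1e//.
  exact: probability_setT.
rewrite /scaled_cost ge0_integral_distribution//; last 2 first.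
- by apply/measurable_EFinP; exact: measurable_scaled_cost.
- by move=> z; rewrite lee_fin sumr_ge0// => i _; exact: sqr_ge0.
pose h i (p : T * V) : \bar R := (4%:E * (expR `|p.2 ord0 i|)%:E)%E.
have mh0 i : measurable_fun setT (fun p : T * V => (expR `|p.2 ord0 i|)%:E).
  apply/measurable_EFinP; do 2 apply: measurableT_comp => //.
  by apply: measurable_fun_coord; exact: measurable_snd.
have mh i : measurable_fun setT (h i) by exact: emeasurable_funM.
have h0 i p : (0 <= h i p)%E by rewrite mule_ge0// lee_fin expR_ge0.
have ih i : (\int[P \x std_normal R n]_p h i p <= 16%:E)%E.
  have iE : (\int[P \x std_normal R n]_p (expR `|p.2 ord0 i|)%:E <= 4%:E)%E.
    apply: (@le_trans _ _ (\int[P]_w \int[std_normal R n]_z (expR `|z ord0 i|)%:E)%E).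
      rewrite le_eqVlt; apply/orP; left; apply/eqP.
      apply: (fubini_tonelli1 (fun p : T * V => (expR `|p.2 ord0 i|)%:E) (mh0 i)).
      by move=> p; rewrite lee_fin expR_ge0.
    by rewrite integral_cst//= probability_setT mule1 integral_std_normal_expR_norm.
  rewrite /h ge0_integralZl//; last exact: mh0.
  have -> : (16%:E = 4%:E * 4%:E :> \bar R)%E by rewrite -EFinM; congr (_%:E); ring.
  by rewrite lee_wpmul2l.
have b0 : (0 <= (2 * beta ^+ 2)%:E :> \bar R)%E by rewrite lee_fin mulr_ge0// sqr_ge0.
apply: (@le_trans _ _ (\int[P \x std_normal R n]_p (\sum_i ((2 * beta ^+ 2)%:E + h i p)))%E).
  apply: ge0_le_integral => //.
  - by move=> p _; rewrite lee_fin sumr_ge0// => i _; exact: sqr_ge0.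
  - apply/measurable_EFinP.
    exact: (measurableT_comp (measurable_scaled_cost 1) mg).
  - by apply: emeasurable_sum => i; apply: emeasurable_funD; [exact: measurable_cst|exact: mh].
  move=> p _ /=; rewrite -sumEFin; apply: lee_sum => i _.
  rewrite /h -EFinM -EFinD lee_fin /g/= mul1r.
  have x2 : X p.1 ord0 i ^+ 2 <= beta ^+ 2.
    by rewrite -(real_normK (num_real _)) lerXn2r ?nnegrE// (le_trans _ beta1).
  have := sqr_le_expR (p.2 ord0 i); have := sqr_ge0 (X p.1 ord0 i + p.2 ord0 i).
  by move: x2; set x := X _ _ _; set y := p.2 _ _; nra.
rewrite ge0_integral_sum//; last 2 first.
- by move=> i; apply: emeasurable_funD; [exact: measurable_cst|exact: mh].
- by move=> i p _; rewrite adde_ge0.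
apply: (@le_trans _ _ (\sum_(i < n) (2 * beta ^+ 2 + 16)%:E)%E).
  apply: lee_sum => i _; rewrite ge0_integralD//; last exact: mh.
  rewrite integral_cst//= probability_setT mule1.
  by rewrite EFinD leeD2l.
rewrite sumEFin sumr_const card_ord -[X in (X%:E <= _)%E]mulr_natl lee_fin.
rewrite (@le_trans _ _ (N%:R * (2 * beta ^+ 2 + 16)))//.
  by rewrite ler_wpM2r ?ler_nat// addr_ge0// mulr_ge0// sqr_ge0.
by rewrite cE; have := ca0; lra.
Qed.

(** A telescoping bound for the harmonic sum: [1 / m <= 2 / (m + 1)], and
    [ln (1 - 1 / (m + 1)) <= - 1 / (m + 1)]. *)
Lemma inv_le_ln_diff m : (0 < m)%N ->
  (m%:R : R)^-1 <= 2 * (ln m.+1%:R - ln m%:R).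
Proof.
move=> m0; have mR : 0 < m%:R :> R by rewrite ltr0n.
have h : ln (1 + (- (m.+1%:R)^-1)) <= - (m.+1%:R)^-1 :> R.
  by apply: le_ln1Dx; rewrite ltrN2 invf_lt1// ltr1n.
have e : 1 + - (m.+1%:R)^-1 = m%:R / m.+1%:R :> R.
  by rewrite -natr1; field; rewrite gt_eqF// addr_gt0.
rewrite e ln_div ?posrE// in h.
have : (m%:R : R)^-1 <= 2 * (m.+1%:R)^-1.
  have m1 : 1 <= m%:R :> R by rewrite ler1n.
  rewrite -[leLHS]mul1r ler_pdivrMr// mulrAC ler_pdivlMr// -natr1; lra.
move=> /le_trans; apply; rewrite ler_pM2l//.
by move: h; rewrite lerNr opprB.
Qed.

(** The horizon [k] is fixed so that one factor [q] serves all steps: step [m] adds at most [q / m],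
    and these errors sum to a logarithm. *)
Lemma coupling_iter k m : (0 < m <= k)%N ->
  exists2 gamma, couplings (mu m) (std_normal R n) gamma &
   (scaled_cost gamma (Num.sqrt m%:R) <=
     ((Num.sqrt c * (8 * (1 + ln k%:R)) ^+ 3 * (1 + 2 * ln m%:R)) ^+ 2)%:E)%E.
Proof.
set L := 8 * (1 + _); set q := Num.sqrt c * _.
move=> /andP[m0 mk].
have k1 : 1 <= k%:R :> R by rewrite ler1n (leq_trans m0).
have lnk0 : 0 <= ln k%:R :> R by exact: ln_ge0.
have L1 : 1 <= L by rewrite /L; lra.
have c0 : 0 < c by exact: lt_le_trans c1.
have q2 : q ^+ 2 = c * L ^+ 6 by rewrite exprMn sqr_sqrtr ?ltW// -exprM.
have q0 : 0 < q by rewrite mulr_gt0 ?sqrtr_gt0// exprn_gt0// (lt_le_trans _ L1).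
elim: m m0 mk => [//|m IH] _ mk.
have [->|m0] := posnP m.
  have [gamma cg cost] := coupling_base.
  exists gamma; rewrite // sqrtr1 ln1 mulr0 addr0 mulr1 (le_trans cost)// lee_fin q2.
  by rewrite ler_peMr ?(ltW c0)// exprn_ege1.
have [gamma cg cost] := IH m0 (ltnW mk).
have mR : 0 < m%:R :> R by rewrite ltr0n.
have m1 : 1 <= m%:R :> R by rewrite ler1n.
have lnm0 : 0 <= ln m%:R :> R by exact: ln_ge0.
pose s : R := Num.sqrt m%:R.
have s2 : s ^+ 2 = m%:R by rewrite sqr_sqrtr// ltW.
have s1 : 1 <= s by rewrite -sqrtr1 ler_sqrt.
have s0 : 0 < s by exact: lt_le_trans s1.
have [F [mF Ftr Fclose]] := knothe_transport beta1 nN mX Xb Xiso s0.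
(* With [s = sqrt m], the requirement [s ^+ 16 <= expR Lm] reads [m ^ 8 <= exp Lm]; hence the factor
   8. The 1 ensures [Lm >= 1] when [m = 1]. *)
pose Lm : R := 8 * (1 + ln m%:R).
have Lm1 : 1 <= Lm by rewrite /Lm; lra.
have LmL : Lm <= L.
  rewrite /Lm /L ler_pM2l// lerD2l ler_ln ?posrE ?ler_nat ?(ltnW mk)//.
  by rewrite (lt_le_trans _ k1).
have sexp : s ^+ 16 <= expR Lm.
  have -> : s ^+ 16 = m%:R ^+ 8 by rewrite (exprM s 2 8) s2.
  have -> : expR Lm = expR 8 * m%:R ^+ 8.
    rewrite /Lm mulrDr mulr1 expRD; congr (_ * _).
    by rewrite -[X in expR (X * _)]/(8%:R) mulr_natl -lnXn// lnK// posrE exprn_gt0.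
  by rewrite ler_peMl ?exprn_ge0// -expR0 ler_expR.
have costF := transport_cost_le mX Xb mF Ftr K1 Lm1 s1 sexp
  (fun y => @Fclose Lm y Lm1).
have q_m : 0 < q / m%:R by rewrite divr_gt0.
have a0 : 0 < q * (1 + 2 * ln m%:R) by rewrite mulr_gt0//; lra.
have costb : ((112 * K ^+ 6 * (Lm ^+ 6 / s ^+ 4) * (n%:R * (5 + n%:R * (4 * expR beta))))%:E <=
   ((q / m%:R) ^+ 2)%:E)%E.
  rewrite lee_fin [(q / _) ^+ 2]exprMn q2 exprVn.
  have -> : s ^+ 4 = m%:R ^+ 2 by rewrite (exprM s 2 2) s2.
  have -> : 112 * K ^+ 6 * (Lm ^+ 6 / m%:R ^+ 2) * (n%:R * (5 + n%:R * (4 * expR beta))) =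
    112 * K ^+ 6 * (n%:R * (5 + n%:R * (4 * expR beta))) * Lm ^+ 6 / m%:R ^+ 2 by ring.
  have K6 := exprn_ge0 6 K0; have e0 := expR_ge0 beta.
  have nNR : n%:R <= N%:R :> R by rewrite ler_nat.
  have n0 : 0 <= n%:R :> R by [].
  have h1 : n%:R * (4 * expR beta) <= N%:R * (4 * expR beta) by rewrite ler_wpM2r// mulr_ge0.
  have h2 : 0 <= n%:R * (4 * expR beta) by rewrite mulr_ge0// mulr_ge0.
  have h3 : n%:R * (5 + n%:R * (4 * expR beta)) <= N%:R * (5 + N%:R * (4 * expR beta)).
    by apply: ler_pM; rewrite ?lerD2l// addr_ge0.
  rewrite ler_pM2r ?invr_gt0 ?exprn_gt0//; apply: ler_pM.
  - by rewrite mulr_ge0 ?mulr_ge0// addr_ge0.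
  - by rewrite exprn_ge0// (le_trans _ Lm1).
  - have h4 : 112 * K ^+ 6 * (n%:R * (5 + n%:R * (4 * expR beta))) <=
       112 * K ^+ 6 * (N%:R * (5 + N%:R * (4 * expR beta))) by rewrite ler_wpM2l// mulr_ge0.
    by rewrite cE; have := cb0; lra.
  - have Lm0 : 0 <= Lm by exact: le_trans Lm1.
    by rewrite lerXn2r ?nnegrE// (le_trans Lm0).
have [gamma' cg' cost'] := coupling_step (mu' := mu m.+1) (r := Num.sqrt (s ^+ 2 + 1))
  (fun A mA => @mu_rec m A mA) cg mX mF Ftr a0 q_m cost (le_trans costF costb).
exists gamma' => //; move: cost'; rewrite s2 natr1 => /le_trans; apply.
have ln1 : 0 <= ln m.+1%:R :> R by rewrite ln_ge0// ler1n.
rewrite lee_fin lerXn2r ?nnegrE//.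
- by rewrite addr_ge0 ?ltW.
- by rewrite mulr_ge0 ?(ltW q0)//; lra.
have := inv_le_ln_diff m0; rewrite -(ler_pM2l q0); lra.
Qed.

Lemma W2_normalized_sum_le k : (0 < k)%N ->
  (W2 (distribution P (normalized_sum eta k)) (std_normal R n) <=
   (Num.sqrt c * (8 * (1 + ln k%:R)) ^+ 3 * (1 + 2 * ln k%:R) / Num.sqrt k%:R)%:E)%E.
Proof.
move=> k0; have [|gamma cg] := @coupling_iter k k; first by rewrite k0 leqnn.
set A := _ * (1 + 2 * _) => cost.
pose V : measurableType _ := 'rV[R]_n.
pose r : R := Num.sqrt k%:R.
have kR : 0 < k%:R :> R by rewrite ltr0n.
have r0 : 0 < r by rewrite sqrtr_gt0.
have r2 : r ^+ 2 = k%:R by rewrite sqr_sqrtr// ltW.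
pose g (z : V * V) : V * V := (r^-1 *: z.1, z.2).
have mg : measurable_fun setT g.
  by apply: measurable_fun_pair => //; exact: measurable_fun_rVZ.
pose g' : {mfun (V * V)%type >-> (V * V)%type} :=
  HB.pack g (isMeasurableFun.Build _ _ _ _ _ mg).
have A0 : 0 <= A.
  have ln0 : 0 <= ln k%:R :> R by rewrite ln_ge0// ler1n.
  by rewrite !mulr_ge0 ?sqrtr_ge0 ?exprn_ge0//; lra.
have Ar : (A / r)%:E = (((A / r) ^+ 2)%:E `^ 2^-1)%E :> \bar R.
  by rewrite poweR_EFin powR12_sqrt ?sqr_ge0// sqrtr_sqr ger0_norm// divr_ge0// ltW.
rewrite /W2 Ar; apply: gt0_ler_poweR => //.
- rewrite in_itv/= leey andbT; apply: le_ereal_inf_tmp => _ [gamma' _ <-].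
  by apply: integral_ge0 => z _; rewrite lee_fin sqr_ge0.
- by rewrite in_itv/= leey lee_fin sqr_ge0.
apply: (@le_trans _ _ (\int[distribution gamma g']_z (enorm (z.1 - z.2) ^+ 2)%:E)%E).
  apply: ereal_inf_lbound; exists (distribution gamma g') => // B mB.
  have mB' : measurable ((fun x : V => r^-1 *: x) @^-1` B).
    have h : measurable_fun setT (fun x : V => r^-1 *: x).
      by apply: measurable_fun_rVZ; exact: measurable_id.
    by rewrite -[X in measurable X]setTI; exact: h.
  split; last first.
    have [_ h] := cg B mB; apply: etrans h.
    rewrite [LHS](_ : _ = gamma (g @^-1` (setT `*` B)))//.
  have [h _] := cg _ mB'; apply: (etrans (etrans _ h)).
    rewrite [LHS](_ : _ = gamma (g @^-1` (B `*` setT)))//.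
  rewrite [LHS](_ : _ = P (partial_sum eta k @^-1` ((fun x : V => r^-1 *: x) @^-1` B)))//.
have enE (z : V * V) : enorm (z.1 - z.2) ^+ 2 = \sum_i (z.1 ord0 i - 1 * z.2 ord0 i) ^+ 2.
  rewrite sqr_sqrtr; last by apply: sumr_ge0 => i _; exact: sqr_ge0.
  by apply: eq_bigr => i _; rewrite !mxE mul1r.
under eq_integral do rewrite enE.
rewrite ge0_integral_distribution//; last 2 first.
- by apply/measurable_EFinP; exact: measurable_scaled_cost.
- by move=> z; rewrite lee_fin sumr_ge0// => i _; exact: sqr_ge0.
(* Dividing the sum by [r = sqrt k] divides the squared cost by [k]. *)
apply: (@le_trans _ _ ((r ^- 2)%:E * scaled_cost gamma r)%E).
  rewrite /scaled_cost -ge0_integralZl//; last 3 first.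
  - by apply/measurable_EFinP; exact: measurable_scaled_cost.
  - by move=> z _; rewrite lee_fin sumr_ge0// => i _; exact: sqr_ge0.
  - by rewrite lee_fin invr_ge0 sqr_ge0.
  rewrite le_eqVlt; apply/orP; left; apply/eqP.
  apply: eq_integral => z _; rewrite -EFinM; congr (_%:E).
  rewrite mulr_sumr; apply: eq_bigr => i _; rewrite /g/= mxE.
  by field; rewrite gt_eqF.
rewrite exprMn exprVn mulrC EFinM lee_wpmul2l//.
by rewrite lee_fin invr_ge0 sqr_ge0.
Qed.

End coupling_rate.

(** * Bounding the dimension and collecting constants *)

Section final.
Context {R : realType}.

(** In dimension 0 the claimed bound vanishes with its factor [d ^ (3/2)], so exact equality of the
    two laws has to be used; the product coupling has cost 0. *)
Lemma W2_dim0 (mu nu : probability 'rV[R]_0 R) : (W2 mu nu <= 0)%E.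
Proof.
have -> : 0%E = (0 `^ 2^-1)%E :> \bar R by rewrite poweR0r.
apply: gt0_ler_poweR => //.
- rewrite in_itv/= leey andbT; apply: le_ereal_inf_tmp => _ [gamma' _ <-].
  by apply: integral_ge0 => z _; rewrite lee_fin sqr_ge0.
- by rewrite in_itv/= leey lexx.
apply: (@le_trans _ _ (\int[(mu \x nu)%E]_z (enorm (z.1 - z.2) ^+ 2)%:E)%E).
  apply: ereal_inf_lbound; exists (mu \x nu)%E => // A mA; split.
    rewrite [LHS]product_measure1E// [X in (_ * X)%E](_ : _ = 1%E) ?mule1//.
    exact: probability_setT.
  rewrite [LHS]product_measure1E// [X in (X * _)%E](_ : _ = 1%E) ?mul1e//.
  exact: probability_setT.
rewrite (eq_integral (cst 0%E)) ?integral0// => z _.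
by rewrite /enorm big_ord0 sqrtr0 expr0n.
Qed.

Lemma isotropic_ae d (T : measurableType d) (P : probability T R) n
    (e : {RV P >-> 'rV[R]_n}) (X : T -> 'rV[R]_n) :
  measurable_fun setT X -> {ae P, forall w, X w = e w} ->
  (forall j, ('E_P[(fun w => e w ord0 j)] = 0)%E) ->
  (forall j l, ('E_P[(fun w => e w ord0 j * e w ord0 l)%R]
        = ((1%:M : 'M[R]_n) j l)%:E)%E) ->
  isotropic P X.
Proof.
move=> mX Xe e1 e2.
have mXi i : measurable_fun setT (fun w => X w ord0 i) by exact: measurable_fun_coord.
have mei i : measurable_fun setT (fun w => e w ord0 i) by exact: measurable_fun_coord.
split=> [i|i j].
  have := e1 i; rewrite unlock /Rintegral => h.
  rewrite -[RHS]/(fine 0%E) -h; congr fine.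
  apply: ae_eq_integral => //; [exact/measurable_EFinP|exact/measurable_EFinP|].
  by apply: filterS Xe => w ->.
have := e2 i j; rewrite unlock /Rintegral mxE => h.
have -> : (i == j)%:R = fine (i == j)%:R%:E :> R by [].
rewrite -h; congr fine.
apply: ae_eq_integral => //; try by apply/measurable_EFinP; exact: measurable_funM.
by apply: filterS Xe => w ->.
Qed.

(** Take the trace of the covariance matrix: the mean of the squared Euclidean norm is [n]. *)
Lemma isotropic_dim_le d (T : measurableType d) (P : probability T R) n
    (X : T -> 'rV[R]_n) (beta : R) : measurable_fun setT X ->
  isotropic P X -> (forall w, \sum_i X w ord0 i ^+ 2 <= beta ^+ 2) ->
  n%:R <= beta ^+ 2.
Proof.
move=> mX [_ X2] Xb.
have mXi i : measurable_fun setT (fun w => X w ord0 i) by exact: measurable_fun_coord.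
have Xi w i : `|X w ord0 i ^+ 2| <= beta ^+ 2.
  rewrite ger0_norm ?sqr_ge0// (le_trans _ (Xb w))// (bigD1 i)//= lerDl.
  by apply: sumr_ge0 => j _; exact: sqr_ge0.
have iX i : P.-integrable setT (EFin \o (fun w => X w ord0 i ^+ 2)).
  apply: (bounded_integrable P _ (fun w => Xi w i)).
  exact: measurable_funX.
have -> : n%:R = \int[P]_w (\sum_i X w ord0 i ^+ 2).
  rewrite Rintegral_sum// (eq_bigr (fun=> 1)) ?sumr_const ?card_ord// => i _.
  by under eq_Rintegral do rewrite expr2; rewrite X2 eqxx.
have m2 : measurable_fun setT (fun w => \sum_i X w ord0 i ^+ 2).
  by apply: measurable_sum => i; exact: measurable_funX.
rewrite (le_trans (ler_norm _))//; apply: bounded_Rintegral_le => // w.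
by rewrite ger0_norm// sumr_ge0// => i _; exact: sqr_ge0.
Qed.

End final.

Theorem corollary48 (R : realType) :
  exists a : R, forall beta : R, exists C : R,
  forall (d : nat) (disp : measure_display) (Omega : measurableType disp)
    (P : probability Omega R) (eta : nat -> {RV P >-> 'rV[R]_d}),
    iid eta ->
    (forall i (j : 'I_d), ('E_P[(fun w => eta i w ord0 j)] = 0)%E) ->
    (forall i (j l : 'I_d),
       ('E_P[(fun w => eta i w ord0 j * eta i w ord0 l)%R]
        = ((1%:M : 'M[R]_d) j l)%:E)%E) ->
    (forall i, {ae P, forall w, enorm (eta i w) <= beta}) ->
    forall k : nat, (2 <= k)%N ->
      (W2 (distribution P (normalized_sum eta k)) (std_normal R d)
       <= (C * d%:R `^ (3 / 2) * ln k%:R `^ a / Num.sqrt k%:R)%:E)%E.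
Proof.
(* Three powers of the logarithm come from [L ^ 3], the fourth from the harmonic sum. *)
exists 4 => beta.
(* [N] bounds every dimension in which the hypotheses can hold, and [b >= 1] bounds all coordinates;
   both depend on [beta] only. *)
pose N := Num.truncn (beta ^+ 2); pose b : R := `|beta| + 1.
(* [kap] is chosen so that [1 + ln k <= kap * ln k] for all [k >= 2]; the 512 in the constant below
   is [8 ^ 3]. *)
pose q : R := Num.sqrt (rate_const b N); pose kap : R := 1 + (ln 2)^-1.
exists (q * 512 * (2 * kap ^+ 4)).
case=> [|d] disp Omega P eta eta_iid eta1 eta2 etab k k2.
  apply: (le_trans (W2_dim0 _ _)); rewrite lee_fin powR0; first by rewrite mulr0 !mul0r.
  by rewrite gt_eqF// divr_gt0.
have [X [mX Xb Xeta]] := bounded_version (etab 0%N).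
have Xiso := isotropic_ae mX Xeta (eta1 0%N) (eta2 0%N).
have dN : (d.+1 <= N)%N.
  by rewrite /N truncn_ge_nat ?sqr_ge0//; exact: isotropic_dim_le Xiso Xb.
have b1 : 1 <= b by rewrite lerDr.
have Xib w i : `|X w ord0 i| <= b.
  have h : `|X w ord0 i| <= `|beta|.
    rewrite -ler_sqr ?nnegrE// !real_normK ?num_real// (le_trans _ (Xb w))//.
    by rewrite (bigD1 i)//= lerDl; apply: sumr_ge0 => j _; exact: sqr_ge0.
  by rewrite (le_trans h)// lerDl.
have k0 : (0 < k)%N by exact: leq_trans k2.
apply: (le_trans (W2_normalized_sum_le eta_iid mX Xeta Xib b1 Xiso dN k0)).
have ln20 : 0 < ln 2 :> R by rewrite ln_gt0// ltr1n.
have lnk2 : ln 2 <= ln k%:R :> R by rewrite ler_ln ?posrE ?ltr0n// ler_nat.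
have lnk0 : 0 <= ln k%:R :> R by rewrite (le_trans _ lnk2)// ltW.
rewrite lee_fin ler_pM2r ?invr_gt0 ?sqrtr_gt0 ?ltr0n// powR_mulrn//.
rewrite -/q exprMn (_ : 8 ^+ 3 = 512); last by ring.
have l1 : 1 + ln k%:R <= kap * ln k%:R.
  by rewrite /kap mulrDl mul1r addrC lerD2l mulrC ler_pdivlMr// mul1r.
have q0 : 0 <= q by exact: sqrtr_ge0.
(* The dimension is already absorbed into [q], so the factor [d ^ (3/2)] is inserted as a number at
   least 1. *)
have d1 : 1 <= d.+1%:R `^ (3 / 2) :> R.
  by rewrite -[leLHS](powRr0 d.+1%:R) ler_powR// ?ler1n// divr_ge0.
have h4 : (1 + ln k%:R) ^+ 3 * (1 + 2 * ln k%:R) <= 2 * (kap * ln k%:R) ^+ 4.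
  have h3 : (1 + ln k%:R) ^+ 4 <= (kap * ln k%:R) ^+ 4.
    by rewrite lerXn2r ?nnegrE ?addr_ge0// (le_trans _ l1)// addr_ge0.
  have h2 : 1 + 2 * ln k%:R <= 2 * (1 + ln k%:R) :> R by rewrite mulrDr mulr1 lerD2r ler1n.
  have h1 : 0 <= (1 + ln k%:R) ^+ 3 :> R by rewrite exprn_ge0// addr_ge0.
  have := ler_wpM2l h1 h2; rewrite mulrCA -exprSr => /le_trans; apply.
  by rewrite ler_pM2l.
have h5 : 0 <= 2 * (kap * ln k%:R) ^+ 4.
  by rewrite (le_trans _ h4)// mulr_ge0 ?exprn_ge0 ?addr_ge0// mulr_ge0.
rewrite exprMn in h4 h5.
have -> : q * 512 * (2 * kap ^+ 4) * d.+1%:R `^ (3 / 2) * ln k%:R ^+ 4 =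
  q * 512 * (2 * (kap ^+ 4 * ln k%:R ^+ 4) * d.+1%:R `^ (3 / 2)) by ring.
have -> : q * (512 * (1 + ln k%:R) ^+ 3) * (1 + 2 * ln k%:R) =
  q * 512 * ((1 + ln k%:R) ^+ 3 * (1 + 2 * ln k%:R)) by ring.
apply: ler_wpM2l; first exact: (mulr_ge0 q0 (ler0n _ _)).
by apply: le_trans h4 _; apply: ler_peMr.
Qed.
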